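(* Let $F:\mathbb{R}^m\to\mathbb{R}^m$ be monotone and $L$-Lipschitz continuous ($L>0$), let $r:\mathbb{R}^m\to\mathbb{R}\cup\{+\infty\}$ be proper, convex and lower semicontinuous, let $B\subset\mathbb{R}^m$ be compact with diameter $D:=\sup_{w,z\in B}\|z-w\|$, and let $z_0\in B$. Let $F(\cdot\,;\xi)$, $\xi\sim Q$, be a stochastic estimator of $F$, and assume: (A1) unbiasedness: $\mathbb{E}_\xi[F(w;\xi)]=F(w)$ for all $w\in\mathbb{R}^m$; (A2) bounded variance: $\mathbb{E}_\xi[\|F(w;\xi)-F(w)\|^2]\le\sigma^2$ for all $w\in\mathbb{R}^m$; (A3) the sample $\xi_k$ is independent of the iterate $w_k$ for all $k\ge 0$. Let $(w_k)_{k\ge0}$ be generated, with step sizes $\alpha_k>0$, by drawing for each $k\ge 0$ samples $\xi_k\sim Q$ (and, where used, $\eta_k\sim Q$) and setting $$w_k=\operatorname{prox}_{\alpha_k r}\big(z_k-\alpha_kF(\diamondsuit_k;\triangle_k)\big),\qquad z_{k+1}=w_k+\alpha_k\big(F(\diamondsuit_k;\triangle_k)-F(w_k;\xi_k)\big).$$ Suppose that one of the following choices is made: (i) (stochastic FBF) $\diamondsuit_k=z_k$ and $\triangle_k=\eta_k$ for all $k\ge0$, with $\alpha_k\le\alpha\le\frac{1}{\sqrt2 L}$; or (ii) (stochastic FBFp) $\diamondsuit_k=w_{k-1}$ and $\triangle_k=\xi_{k-1}$ for all $k\ge0$, with $w_{-1}=z_0$ and $\xi_{-1}=\eta_0$,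 and with $\alpha_k\le\alpha\le\frac{1}{3L}$. Then for all $K\ge1$ the averaged iterates $\bar w_K:=\frac{\sum_{k=0}^{K-1}\alpha_kw_k}{\sum_{k=0}^{K-1}\alpha_k}$ satisfy $$\mathbb{E}[G_B(\bar w_K)]\le\frac{D^2+18\sigma^2\sum_{k=0}^{K-1}\alpha_k^2}{2\sum_{k=0}^{K-1}\alpha_k},$$ where $G_B$ is the restricted (unifying) gap function defined in the context.
   Context: For $\lambda>0$, $\operatorname{prox}_{\lambda r}(w):=\operatorname{argmin}_{w'\in\mathbb{R}^m}\{r(w')+\frac{1}{2\lambda}\|w'-w\|^2\}$. Minimax case: we say that $F$ and $r$ come from a minimax problem if $m=d+n$ and there are a convex-concave differentiable function $\Phi:\mathbb{R}^d\times\mathbb{R}^n\to\mathbb{R}$ (convex in the first, concave in the second argument; possibly given as an expectation $\Phi(x,y)=\mathbb{E}_{\xi\sim Q}[\Phi(x,y;\xi)]$) with $L$-Lipschitz continuous gradient and proper, convex, lower semicontinuous functions $f:\mathbb{R}^d\to\mathbb{R}\cup\{+\infty\}$, $h:\mathbb{R}^n\to\mathbb{R}\cup\{+\infty\}$ such that $F(x,y)=(\nabla_x\Phi(x,y),-\nabla_y\Phi(x,y))$ and $r(x,y)=f(x)+h(y)$. In this case put $\Psi(x,y):=f(x)+\Phi(x,y)-h(y)$; the associated problem is $\min_{x}\max_{y}\Psi(x,y)$. The restricted (unifying) gap function with respect to $B$ is, for $w\in\mathbb{R}^m$ (written $w=(u,v)\in\mathbb{R}^d\times\mathbb{R}^n$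 in the minimax case), $$G_B(w):=\begin{cases}\sup_{(x,y)\in B}\ \Psi(u,y)-\Psi(x,v) & \text{if } F \text{ and } r \text{ come from a minimax problem},\\ \sup_{z\in B}\ \langle F(z),w-z\rangle+r(w)-r(z) & \text{otherwise.}\end{cases}$$ (So the claim asserts the bound for the second expression for general $F,r$, and for the first expression in the minimax case.) *)

(* Defs.v *)
From mathcomp Require Import all_boot all_order all_algebra.
From mathcomp Require Import all_classical all_reals all_analysis.

Set Implicit Arguments.
Unset Strict Implicit.
Unset Printing Implicit Defensive.

Import Order.TTheory GRing.Theory Num.Theory.
Import numFieldNormedType.Exports.

Local Open Scope classical_set_scope.
Local Open Scope ring_scope.

(* R^m is 'rV[R]_m.  The norm that the library puts on matrices is the
   sup norm, so the Euclidean structure is defined here; both norms induce the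
   topology of 'rV[R]_m, on which compact, open, lower_semicontinuous and
   differentiable rely. *)
Definition dotv (R : realType) (m : nat) (x y : 'rV[R]_m) : R :=
  \sum_(i < m) x 0 i * y 0 i.

Definition enorm (R : realType) (m : nat) (x : 'rV[R]_m) : R :=
  Num.sqrt (dotv x x).

Definition diameter (R : realType) (m : nat) (B : set 'rV[R]_m) : R :=
  sup [set enorm (p.2 - p.1) | p in B `*` B].

Definition monotone_op (R : realType) (m : nat) (F : 'rV[R]_m -> 'rV[R]_m) :=
  forall x y, 0 <= dotv (F x - F y) (x - y).

Definition lipschitz_op (R : realType) (m : nat) (L : R)
    (F : 'rV[R]_m -> 'rV[R]_m) :=
  forall x y, enorm (F x - F y) <= L * enorm (x - y).

Definition proper_fun (R : realType) (m : nat) (r : 'rV[R]_m -> \bar R) :=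
  (forall x, r x != -oo%E) /\ exists x, r x \is a fin_num.

(* 0 * +oo = 0 in \bar R, so the endpoints t = 0 and t = 1 are harmless. *)
Definition econvex (R : realType) (m : nat) (r : 'rV[R]_m -> \bar R) :=
  forall (x y : 'rV[R]_m) (t : R), 0 <= t -> t <= 1 ->
    (r (t *: x + (1 - t) *: y)%R <= t%:E * r x + (1 - t)%:E * r y)%E.

Definition proper_convex_lsc (R : realType) (m : nat)
    (r : 'rV[R]_m -> \bar R) :=
  [/\ proper_fun r, econvex r & lower_semicontinuous r].

Definition argmin (R : realType) (T : Type) (g : T -> \bar R) : set T :=
  [set x | forall y, (g x <= g y)%E].

(* prox lambda r w is the proximal point of lambda * r at w; for a proper,
   convex, lower semicontinuous r the argmin is a singleton. *)
Definition prox (R : realType) (m : nat) (lambda : R) (r : 'rV[R]_m -> \bar R)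
    (w : 'rV[R]_m) : 'rV[R]_m :=
  xget 0 (argmin (fun w' : 'rV[R]_m =>
    r w' + ((2 * lambda)^-1 * enorm (w' - w) ^+ 2)%:E)%E).

Definition grad (R : realType) (m : nat) (Phi : 'rV[R]_m -> R)
    (w : 'rV[R]_m) : 'rV[R]_m :=
  \row_i 'D_(delta_mx 0 i) Phi w.

(* Phi is a function of the concatenation (x, y) = row_mx x y. *)
Definition convex_concave (R : realType) (d n : nat)
    (Phi : 'rV[R]_(d + n) -> R) :=
  (forall y : 'rV[R]_n, convex_function setT
     (fun x : convex_lmodType 'rV[R]_d => Phi (row_mx x y) : R^o)) /\
  (forall x : 'rV[R]_d, convex_function setT
     (fun y : convex_lmodType 'rV[R]_n => - Phi (row_mx x y) : R^o)).

(* The two situations distinguished by the gap function: an arbitrary pair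
   (F, r), or a pair that comes from the minimax problem given by Phi, f, h. *)
Variant problem (R : realType) : nat -> Type :=
| General (m : nat) (F : 'rV[R]_m -> 'rV[R]_m) (r : 'rV[R]_m -> \bar R) :
    problem R m
| Minimax (d n : nat) (Phi : 'rV[R]_(d + n) -> R)
    (f : 'rV[R]_d -> \bar R) (h : 'rV[R]_n -> \bar R) :
    problem R (d + n).

Definition minimax_op (R : realType) (d n : nat) (Phi : 'rV[R]_(d + n) -> R)
    (w : 'rV[R]_(d + n)) : 'rV[R]_(d + n) :=
  row_mx (lsubmx (grad Phi w)) (- rsubmx (grad Phi w)).

Definition minimax_reg (R : realType) (d n : nat)
    (f : 'rV[R]_d -> \bar R) (h : 'rV[R]_n -> \bar R)
    (w : 'rV[R]_(d + n)) : \bar R :=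
  (f (lsubmx w) + h (rsubmx w))%E.

Definition operator (R : realType) (m : nat) (p : problem R m) :
    'rV[R]_m -> 'rV[R]_m :=
  match p with
  | General _ F _ => F
  | Minimax _ _ Phi _ _ => minimax_op Phi
  end.

Definition regularizer (R : realType) (m : nat) (p : problem R m) :
    'rV[R]_m -> \bar R :=
  match p with
  | General _ _ r => r
  | Minimax _ _ _ f h => minimax_reg f h
  end.

Definition minimax_assumptions (R : realType) (m : nat) (L : R)
    (p : problem R m) : Prop :=
  match p with
  | General _ _ _ => True
  | Minimax _ _ Phi f h =>
      [/\ convex_concave Phi, forall w, differentiable Phi w,
          lipschitz_op L (grad Phi), proper_convex_lsc f
        & proper_convex_lsc h]
  end.

Definition saddle_fun (R : realType) (d n : nat) (Phi : 'rV[R]_(d + n) -> R)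
    (f : 'rV[R]_d -> \bar R) (h : 'rV[R]_n -> \bar R)
    (x : 'rV[R]_d) (y : 'rV[R]_n) : \bar R :=
  (f x + (Phi (row_mx x y))%:E - h y)%E.

Definition minimax_gap (R : realType) (d n : nat) (Phi : 'rV[R]_(d + n) -> R)
    (f : 'rV[R]_d -> \bar R) (h : 'rV[R]_n -> \bar R)
    (B : set 'rV[R]_(d + n)) (w : 'rV[R]_(d + n)) : \bar R :=
  ereal_sup [set (saddle_fun Phi f h (lsubmx w) (rsubmx z)
                  - saddle_fun Phi f h (lsubmx z) (rsubmx w))%E | z in B].

Definition general_gap (R : realType) (m : nat) (F : 'rV[R]_m -> 'rV[R]_m)
    (r : 'rV[R]_m -> \bar R) (B : set 'rV[R]_m) (w : 'rV[R]_m) : \bar R :=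
  ereal_sup [set ((dotv (F z) (w - z))%:E + r w - r z)%E | z in B].

(* Since +oo - oo = -oo in \bar R, the value is only meaningful where the
   regularizer is finite at w, which holds at every average of the iterates. *)
Definition gap (R : realType) (m : nat) (p : problem R m) :
    set 'rV[R]_m -> 'rV[R]_m -> \bar R :=
  match p with
  | General _ F r => general_gap F r
  | Minimax _ _ Phi f h => minimax_gap Phi f h
  end.

Definition borel_rV (R : realType) (m : nat) :=
  g_sigma_algebraType [set A : set 'rV[R]_m | open A].

Definition independent_rv (d d1 d2 : measure_display) (Om : measurableType d)
    (T1 : measurableType d1) (T2 : measurableType d2) (R : realType)
    (P : probability Om R) (X : Om -> T1) (Y : Om -> T2) :=
  forall (A : set T1) (C : set T2), measurable A -> measurable C ->
    P (X @^-1` A `&` Y @^-1` C) = (P (X @^-1` A) * P (Y @^-1` C))%E.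

Definition mutually_independent (d d' : measure_display)
    (Om : measurableType d) (Xi : measurableType d') (R : realType)
    (P : probability Om R) (I : choiceType) (X : I -> Om -> Xi) :=
  forall (s : seq I) (A : I -> set Xi), uniq s ->
    (forall i, measurable (A i)) ->
    P (\bigcap_(i in [set` s]) (X i @^-1` A i)) =
    (\prod_(i <- s) P (X i @^-1` A i))%E.

(* The samples X i, i : I, are drawn from Q: independent of each other, each
   with law Q. *)
Definition drawn_from (d d' : measure_display)
    (Om : measurableType d) (Xi : measurableType d') (R : realType)
    (P : probability Om R) (Q : probability Xi R)
    (I : choiceType) (X : I -> {mfun Om >-> Xi}) :=
  (forall i A, measurable A -> distribution P (X i) A = Q A) /\
  mutually_independent P (fun i => X i : Om -> Xi).

(* The estimator is jointly Borel measurable (componentwise), unbiased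
   (componentwise), and of variance at most sigma ^+ 2. *)
Definition stochastic_estimator (d' : measure_display)
    (Xi : measurableType d') (R : realType) (Q : probability Xi R) (m : nat)
    (sigma : R) (F : 'rV[R]_m -> 'rV[R]_m)
    (Fs : 'rV[R]_m -> Xi -> 'rV[R]_m) :=
  [/\ forall i, measurable_fun setT
        (fun p : borel_rV R m * Xi => Fs p.1 p.2 0 i),
      forall w i, ('E_Q[fun s => (Fs w s 0 i)%R] = (F w 0 i)%:E)%E
    & forall w,
        ('E_Q[fun s => (enorm (Fs w s - F w) ^+ 2)%R] <= (sigma ^+ 2)%:E)%E].

(* The k-th step evaluates the estimator at (diamond k, triangle k). *)
Definition tseng_iteration (Om Xi : Type) (R : realType) (m : nat)
    (Fs : 'rV[R]_m -> Xi -> 'rV[R]_m) (r : 'rV[R]_m -> \bar R)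
    (alpha : nat -> R) (xi : nat -> Om -> Xi) (z0 : 'rV[R]_m)
    (diamond : nat -> Om -> 'rV[R]_m) (triangle : nat -> Om -> Xi)
    (z w : nat -> Om -> 'rV[R]_m) :=
  (forall om, z 0%N om = z0) /\
  forall k om, let g := Fs (diamond k om) (triangle k om) in
    w k om = prox (alpha k) r (z k om - alpha k *: g) /\
    z k.+1 om = w k om + alpha k *: (g - Fs (w k om) (xi k om)).

(* The sequence k |-> u (k - 1), with u (-1) = a. *)
Definition delay (T : Type) (a : T) (u : nat -> T) (k : nat) : T :=
  if k is j.+1 then u j else a.

Definition stochastic_FBF (d d' : measure_display)
    (Om : measurableType d) (Xi : measurableType d') (R : realType)
    (P : probability Om R) (Q : probability Xi R) (m : nat)
    (Fs : 'rV[R]_m -> Xi -> 'rV[R]_m) (r : 'rV[R]_m -> \bar R)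
    (alpha : nat -> R) (xi eta : nat -> {mfun Om >-> Xi}) (z0 : 'rV[R]_m)
    (z w : nat -> Om -> 'rV[R]_m) :=
  drawn_from P Q
    (fun i : nat + nat => match i with inl k => xi k | inr k => eta k end) /\
  tseng_iteration Fs r alpha xi z0 z eta z w.

(* eta 0 is the only sample used besides the xi k. *)
Definition stochastic_FBFp (d d' : measure_display)
    (Om : measurableType d) (Xi : measurableType d') (R : realType)
    (P : probability Om R) (Q : probability Xi R) (m : nat)
    (Fs : 'rV[R]_m -> Xi -> 'rV[R]_m) (r : 'rV[R]_m -> \bar R)
    (alpha : nat -> R) (xi eta : nat -> {mfun Om >-> Xi}) (z0 : 'rV[R]_m)
    (z w : nat -> Om -> 'rV[R]_m) :=
  drawn_from P Q
    (fun i : option nat => if i is Some k then xi k else eta 0%N) /\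
  tseng_iteration Fs r alpha xi z0
    (delay (cst z0) w) (delay (eta 0%N : Om -> Xi) (fun k => xi k)) z w.

Definition averaged (Om : Type) (R : realType) (m : nat) (alpha : nat -> R)
    (w : nat -> Om -> 'rV[R]_m) (K : nat) (om : Om) : 'rV[R]_m :=
  (\sum_(k < K) alpha k)^-1 *: \sum_(k < K) alpha k *: w k om.

(* Main.v *)
Require Import Defs.
From mathcomp Require Import all_boot all_order all_algebra.
From mathcomp Require Import all_classical all_reals all_analysis.
From mathcomp Require Import measurable_realfun ring lra.

(* Write [eps_k] for the noise of the sample [xi_k] at [w_k], [e_k] for the
   noise in the prox step, and [S] for the sum of the [alpha_k eps_k].  The
   usual one-step inequality telescopes to
     sum alpha_k (<F w_k, w_k - y> + r w_k - r y) <=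
       |z_0 - y|^2 / 2 - |z_K - y|^2 / 2 + <S, y> + (terms without y).
   Completing the square in [y] replaces the last two terms in [y] by
   |S|^2 / 2 + <z_K, S>, so that the supremum over [y] costs only D^2 / 2.
   The expectation of <z_K, S> is not zero, but it does not change when the
   end point [z'_K] of a deterministic run is subtracted from [z_K].  For the
   run of the same algorithm without noise, monotonicity bounds the
   expectation of |z_K - z'_K|^2 by a multiple of sigma^2 sum alpha_k^2 plus a
   multiple of the expectation of sum |z_k - w_k|^2, and the latter is absorbed
   by the negative terms of the telescoped inequality. *)

(** The point [y] that attains the gap depends on the samples, so <S, y> has no vanishing mean, and
    the supremum has to be taken before the expectation. The end point [z_K] depends on the samples
    as well, and nothing bounds the iterates in advance. A deterministic point can be subtracted
    because [S] has mean zero, and the noise-free run is the natural one because it starts at the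
    same [z_0]. A second dependence lies in the prox step: [w_k] is computed from the noise [e_k],
    and in FBFp so is [z_k], because the sample xi_{k-1} is used twice. Recomputing [w_k] without
    that noise changes [F] by at most 3/4 |e_k|. Hence each forward step carries the noise term 7/2
    sigma^2 = (1 + 1 + 2 * 3/4) sigma^2. With the Young weights 1/8 and 1/4 the total noise factors
    are 207/32 for FBF and 269/32 for FBFp, both below 9, which is half of 18. *)

Set Implicit Arguments.
Unset Strict Implicit.
Unset Printing Implicit Defensive.

Import Order.TTheory GRing.Theory Num.Theory.
Import numFieldNormedType.Exports.

Local Open Scope classical_set_scope.
Local Open Scope ring_scope.

(** * Euclidean space and the proximal operator *)

Section euclidean.
Context {R : realType} {m : nat}.
Implicit Types (x y z : 'rV[R]_m) (c : R).

Lemma dotvC x y : dotv x y = dotv y x.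
Proof. by apply: eq_bigr => i _; rewrite mulrC. Qed.

Lemma dotvDl x y z : dotv (x + y) z = dotv x z + dotv y z.
Proof. by rewrite -big_split; apply: eq_bigr => i _; rewrite mxE mulrDl. Qed.

Lemma dotvZl c x y : dotv (c *: x) y = c * dotv x y.
Proof. by rewrite mulr_sumr; apply: eq_bigr => i _; rewrite mxE mulrA. Qed.

Lemma dotvNl x y : dotv (- x) y = - dotv x y.
Proof. by rewrite -scaleN1r dotvZl mulN1r. Qed.

Lemma dotvDr x y z : dotv x (y + z) = dotv x y + dotv x z.
Proof. by rewrite dotvC dotvDl !(dotvC x). Qed.

Lemma dotvZr c x y : dotv x (c *: y) = c * dotv x y.
Proof. by rewrite dotvC dotvZl (dotvC x). Qed.

Lemma dotvNr x y : dotv x (- y) = - dotv x y.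
Proof. by rewrite dotvC dotvNl (dotvC x). Qed.

Lemma dot0v x : dotv 0 x = 0.
Proof. by rewrite -(scale0r 0) dotvZl mul0r. Qed.

Lemma dotv0 x : dotv x 0 = 0.
Proof. by rewrite dotvC dot0v. Qed.

Lemma dotv_suml (I : Type) (s : seq I) (P : pred I) (f : I -> 'rV[R]_m) x :
  dotv (\sum_(i <- s | P i) f i) x = \sum_(i <- s | P i) dotv (f i) x.
Proof.
by elim/big_ind2: _ => [|? y ? z <- <-|//]; rewrite ?dot0v ?dotvDl.
Qed.

Definition dotvE := (dotvDl, dotvDr, dotvNl, dotvNr, dotvZl, dotvZr).

Lemma dotv_ge0 x : 0 <= dotv x x.
Proof. by apply: sumr_ge0 => i _; rewrite -expr2 sqr_ge0. Qed.

Lemma enorm_ge0 x : 0 <= enorm x.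
Proof. exact: sqrtr_ge0. Qed.

Lemma enorm_sqr x : enorm x ^+ 2 = dotv x x.
Proof. by rewrite sqr_sqrtr ?dotv_ge0. Qed.

Lemma enorm0 : enorm (0 : 'rV[R]_m) = 0.
Proof. by rewrite /enorm dot0v sqrtr0. Qed.

Lemma enormZ c x : enorm (c *: x) = `|c| * enorm x.
Proof.
by rewrite /enorm !dotvE mulrA -expr2 sqrtrM ?sqr_ge0// sqrtr_sqr.
Qed.

Lemma enormN x : enorm (- x) = enorm x.
Proof. by rewrite -scaleN1r enormZ normrN1 mul1r. Qed.

Lemma enormB x y : enorm (x - y) = enorm (y - x).
Proof. by rewrite -enormN opprB. Qed.

Lemma coord_le_enorm x i : `|x 0 i| <= enorm x.
Proof.
rewrite -sqrtr_sqr ler_wsqrtr// /dotv (bigD1 i)//= -expr2 lerDl.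
by apply: sumr_ge0 => j _; rewrite -expr2 sqr_ge0.
Qed.

Lemma young_dotv c x y : 0 < c ->
  2 * dotv x y <= c * dotv x x + c^-1 * dotv y y.
Proof.
move=> c0; have := dotv_ge0 (c *: x - y).
rewrite !dotvE (dotvC y x) => h.
rewrite -(ler_pM2l c0) mulrDr (mulrA c c^-1) divff ?gt_eqF// mul1r.
by nra.
Qed.

Lemma dotv_le_sub x y :
  dotv x x <= 2 * dotv (x - y) (x - y) + 2 * dotv y y.
Proof.
by have := dotv_ge0 (x - 2 *: y); rewrite !dotvE (dotvC y x); lra.
Qed.

Lemma cauchy_schwarz x y : dotv x y <= enorm x * enorm y.
Proof.
have [x0|x0] := leP (enorm x) 0.
  have {}x0 : enorm x = 0 by apply/eqP; rewrite eq_le x0 enorm_ge0.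
  rewrite x0 mul0r; have := enorm_sqr x; rewrite x0 expr0n/= => /esym/eqP.
  rewrite psumr_eq0 => [/allP/= xi|i _]; last by rewrite -expr2 sqr_ge0.
  rewrite /dotv big1// => i _; have := xi i (mem_index_enum _).
  by rewrite mulf_eq0 orbb => /eqP ->; rewrite mul0r.
have [y0|y0] := leP (enorm y) 0.
  have {}y0 : enorm y = 0 by apply/eqP; rewrite eq_le y0 enorm_ge0.
  rewrite y0 mulr0; have := enorm_sqr y; rewrite y0 expr0n/= => /esym/eqP.
  rewrite psumr_eq0 => [/allP/= xi|i _]; last by rewrite -expr2 sqr_ge0.
  rewrite /dotv big1// => i _; have := xi i (mem_index_enum _).
  by rewrite mulf_eq0 orbb => /eqP ->; rewrite mulr0.
(* This weight makes the two terms on the right of Young's inequality equal. *)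
have := @young_dotv (enorm y / enorm x) x y (divr_gt0 y0 x0).
rewrite -!enorm_sqr invf_div => /le_trans h.
rewrite -(ler_pM2l (ltr0n _ 2)); apply: h.
have -> : enorm y / enorm x * enorm x ^+ 2 + enorm x / enorm y * enorm y ^+ 2
  = 2 * (enorm x * enorm y) by field; rewrite !gt_eqF.
by [].
Qed.

Lemma enormD x y : enorm (x + y) <= enorm x + enorm y.
Proof.
rewrite -(@ler_pXn2r _ 2)// ?nnegrE ?addr_ge0 ?enorm_ge0//.
rewrite sqrrD !enorm_sqr !dotvE (dotvC y x).
by have := cauchy_schwarz x y; lra.
Qed.

End euclidean.

(** * Minima of lower semicontinuous functions on compact sets *)

Section lower_semicontinuity.
Context {R : realType}.

(** The sublevel sets of [f] in [K] at the values of [f] on [K] are nested and nonempty, so they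
    generate a proper filter. Any of its cluster points is a minimum. *)
Lemma compact_lsc_min (T : topologicalType) (f : T -> \bar R) (K : set T) :
  lower_semicontinuous f -> (forall x, f x != -oo%E) -> compact K ->
  K !=set0 -> exists2 x, K x & forall y, K y -> (f x <= f y)%E.
Proof.
move=> lf fNy cK [x0 Kx0].
pose G := filter_from K (fun y => K `&` [set x | (f x <= f y)%E]).
have PG : ProperFilter G.
  apply: filter_from_proper; last by move=> y Ky; exists y; split => /=.
  apply: filter_from_filter; first by exists x0.
  move=> i j Ki Kj; have [ij|/ltW ji] := leP (f i) (f j).
    exists i => // x [Kx xi]; do 2!split => //=.
    exact: le_trans xi ij.
  exists j => // x [Kx xj]; do 2!split => //=.
  exact: le_trans xj ji.
have GK : G K by exists x0 => // x [].
have [x [Kx clx]] := cK G PG GK.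
exists x => // y Ky; rewrite leNgt; apply/negP => yx.
(* Lower semicontinuity speaks of real levels only, so a real number is inserted between the two
   extended values. *)
have [a ya ax] : exists2 a : R, (f y <= a%:E)%E & (a%:E < f x)%E.
  move: (fNy y) yx; case: (f y) => [s||]//= _; last by rewrite ltNge leey.
  case: (f x) => [t||]//.
  - by rewrite lte_fin => st; exists s; rewrite ?lte_fin.
  - by move=> _; exists s; rewrite ?ltry.
have [V Vx Va] := lf x a ax.
have [w [[Kw /= wy] /Va aw]] := clx _ _ (ex_intro2 _ _ y Ky (fun _ => id)) Vx.
by have := lt_le_trans aw (le_trans wy ya); rewrite ltxx.
Qed.

Lemma lower_semicontinuousD (T : topologicalType) (f : T -> \bar R)
    (q : T -> R) :
  lower_semicontinuous f -> (forall x, f x != -oo%E) -> continuous q ->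
  lower_semicontinuous (fun x => f x + (q x)%:E)%E.
Proof.
move=> lf fNy cq x a ax.
have [b [c [bx cx abc]]] : exists b c : R,
    [/\ (b%:E < f x)%E, c < q x & a <= b + c].
  move: (fNy x) ax; case: (f x) => [s||]//= _.
  - rewrite -EFinD lte_fin => asq; exists (s - (s + q x - a) / 2).
    exists (q x - (s + q x - a) / 2); split; rewrite ?lte_fin; lra.
  - move=> _; exists (a - (q x - 1)), (q x - 1); split; rewrite ?ltry//; lra.
have [V Vx Vb] := lf x b bx.
have Wx : nbhs x [set y | c < q y].
  exact: (cvgr_gt (q x) (cq x)).
exists (V `&` [set y | c < q y]); first exact: filterI.
move=> y [/Vb by_ /= cy]; apply: (@le_lt_trans _ _ (b%:E + c%:E)%E).
  by rewrite -EFinD lee_fin.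
by apply: lteD; rewrite ?lte_fin.
Qed.

End lower_semicontinuity.

(** * Existence and basic inequalities of the proximal point *)

Section prox.
Context {R : realType} {m : nat}.
Implicit Types (r : 'rV[R]_m -> \bar R) (x y v : 'rV[R]_m).

Lemma continuous_dist_sqr (v : 'rV[R]_m) (c : R) :
  continuous (fun y : 'rV[R]_m => c * enorm (y - v) ^+ 2).
Proof.
rewrite (_ : (fun y => _) = (fun y : 'rV[R]_m =>
    c * \sum_(i < m) (y 0 i - v 0 i) * (y 0 i - v 0 i))); last first.
  apply/funext => x; rewrite enorm_sqr; congr (_ * _).
  by apply: eq_bigr => i _; rewrite !mxE.
move=> y; have cc : (fun=> c) x @[x --> y] --> c.
  exact: (@cvg_cst _ c _ (nbhs y)).
apply: (cvgM cc).
apply: (@cvg_big R _ +%R 0 xpredT) => [|i _]; first exact: add_continuous.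
have cy : (fun x : 'rV[R]_m => x 0 i - v 0 i) x @[x --> y] --> y 0 i - v 0 i.
  exact: (cvgB (@coord_continuous _ 1 m 0 i y)
    (@cvg_cst _ (v 0 i) _ (nbhs y) _)).
exact: (cvgM cy cy).
Qed.

Lemma box_compact (x : 'rV[R]_m) (c : R) :
  compact [set y : 'rV[R]_m | forall i, y 0 i \in `[x 0 i - c, x 0 i + c]].
Proof.
apply: (@rV_compact _ _ (fun i => `[x 0 i - c, x 0 i + c]%classic)) => i.
exact: segment_compact.
Qed.

Lemma enorm_box (x y : 'rV[R]_m) c i :
  enorm (y - x) <= c -> y 0 i \in `[x 0 i - c, x 0 i + c].
Proof.
move=> yxc; have := le_trans (coord_le_enorm (y - x) i) yxc.
by rewrite !mxE ler_norml in_itv/= => /andP[? ?]; apply/andP; split; lra.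
Qed.

(* A lower semicontinuous convex function is bounded below on a ball around a
   point of its domain, hence by convexity it decreases at most linearly; this
   replaces the affine minorant given by the Hahn-Banach theorem. *)
Lemma convex_linear_minorant r x0 : proper_convex_lsc r -> r x0 \is a fin_num ->
  exists2 A : R, 0 <= A &
    forall x, 1 <= enorm (x - x0) -> ((- (A * enorm (x - x0)))%:E <= r x)%E.
Proof.
move=> [[rNy _] cr lr] rx0.
have x0box (i : 'I_m) : x0 0 i \in `[x0 0 i - 1, x0 0 i + 1].
  by apply: enorm_box; rewrite subrr enorm0.
have [x1 _ x1min] := compact_lsc_min lr rNy (@box_compact x0 1)
  (ex_intro _ x0 x0box).
have x1x0 : (r x1 <= r x0)%E.
  exact: x1min.
have rx1 : r x1 \is a fin_num.
  by rewrite fin_numE rNy/= lt_eqF// (le_lt_trans x1x0)// ltey_eq rx0.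
exists (`|fine (r x1)| + `|fine (r x0)|); first by rewrite addr_ge0.
move=> x; set t := enorm _ => t1.
have t0 : 0 < t by rewrite (lt_le_trans _ t1).
have tV0 : 0 <= t^-1 by rewrite invr_ge0 ltW.
have tV1 : t^-1 <= 1 by rewrite invf_le1.
(* This convex combination is the point at distance 1 from [x0] in the direction of [x]; it lies in
   the box on which [x1] minimizes [r]. *)
have := cr x x0 t^-1 tV0 tV1.
set p := (_ + _)%R => pr.
have {pr} := le_trans (x1min p _) pr; rewrite -(fineK rx0) -(fineK rx1).
have pbox : forall i, p 0 i \in `[x0 0 i - 1, x0 0 i + 1].
  move=> i; apply: enorm_box; rewrite /p scalerBl scale1r addrCA addrAC subrr.
  by rewrite add0r -scalerBr enormZ ger0_norm// mulVf// gt_eqF.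
move=> /(_ pbox).
move: (rNy x); case: (r x) => [s||]//= _; last by rewrite leey.
rewrite -!EFinM -EFinD !lee_fin => h.
have {}h : t * fine (r x1) <= s + (t - 1) * fine (r x0).
  have -> : s + (t - 1) * fine (r x0) =
      t * (t^-1 * s + (1 - t^-1) * fine (r x0)).
    by field; rewrite gt_eqF.
  by rewrite ler_pM2l.
have := ler_norm (- fine (r x1)); have := ler_norm (fine (r x0)).
have := ler_norm (- fine (r x0)); rewrite !normrN; nra.
Qed.

(** The quadratic term beats the linear minorant of [r] far from [x0], so the minimum over a large
    box is a global one. *)
Lemma prox_argmin (lam : R) r v : 0 < lam -> proper_convex_lsc r ->
  argmin (fun y : 'rV[R]_m =>
    r y + ((2 * lam)^-1 * enorm (y - v) ^+ 2)%:E)%E (prox lam r v).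
Proof.
move=> lam0 pr; have [[rNy [x0 rx0]] cr lr] := pr.
set g := (X in argmin X); suff [x xmin] : exists x, argmin g x.
  exact: (@xgetPex _ 0 (argmin g) (ex_intro _ x xmin)).
pose k := (2 * lam)^-1; have k0 : 0 < k by rewrite invr_gt0 mulr_gt0.
have gNy y : g y != -oo%E by rewrite adde_eq_ninfty negb_or rNy.
have lg : lower_semicontinuous g.
  by apply: lower_semicontinuousD => //; exact: continuous_dist_sqr.
have [A A0 rA] := convex_linear_minorant pr rx0.
pose c := enorm (x0 - v); have c0 : 0 <= c := enorm_ge0 _.
(* For t > T one has k t >= 2 k c + A + |r x0|, hence k (t - c)^2 - A t >= t |r x0| + k c^2, which
   is at least the objective at [x0]. *)
pose T := 1 + (2 * k * c + A + `|fine (r x0)|) / k.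
have T1 : 1 <= T by rewrite lerDl divr_ge0 ?addr_ge0 ?mulr_ge0 ?(ltW k0).
have x0box (i : 'I_m) : x0 0 i \in `[x0 0 i - T, x0 0 i + T].
  by apply: enorm_box; rewrite subrr enorm0 (le_trans _ T1).
have [x _ xmin] := compact_lsc_min lg gNy (@box_compact x0 T)
  (ex_intro _ x0 x0box).
exists x => y; have [yT|Ty] := leP (enorm (y - x0)) T.
  by apply: xmin => i; exact: enorm_box.
apply: le_trans (xmin _ x0box) _.
have y1 := le_trans T1 (ltW Ty); have := rA y y1.
set t := enorm (y - x0) in Ty y1 *.
rewrite /g -(fineK rx0) -/k -/c; case: (r y) (rNy y) => [s _||]//=; last first.
  by move=> _ *; rewrite leey.
rewrite -!EFinD !lee_fin => h.
have tc : t - c <= enorm (y - v).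
  have := enormD (y - v) (v - x0); rewrite addrA subrK (enormB v) -/t -/c; lra.
have kT : 2 * k * c + A + `|fine (r x0)| <= k * t.
  rewrite (mulrC k) -ler_pdivrMr//; move: Ty; rewrite /T; lra.
have k2 : k * (t - c) ^+ 2 <= k * enorm (y - v) ^+ 2.
  rewrite ler_pM2l//; have [tc0|tc0] := leP (t - c) 0.
    have : 0 < k * c by rewrite mulr_gt0//; lra.
    have : k * (t - c) <= 0 by rewrite pmulr_rle0.
    by have := normr_ge0 (fine (r x0)); lra.
  by rewrite lerXn2r// nnegrE ?enorm_ge0// ltW.
have kc0 : 0 <= k * c by rewrite mulr_ge0// ltW.
have kc2 : 0 <= k * c * c by rewrite mulr_ge0.
have := ler_norm (fine (r x0)); have := normr_ge0 (fine (r x0)).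
have : t * (2 * k * c + A + `|fine (r x0)|) <= t * (k * t).
  by rewrite ler_pM2l// (lt_le_trans _ y1).
nra.
Qed.

Lemma prox_fin_num (lam : R) r v : 0 < lam -> proper_convex_lsc r ->
  r (prox lam r v) \is a fin_num.
Proof.
move=> lam0 pr; have [[rNy [x0 rx0]] _ _] := pr.
have /(_ x0) := prox_argmin v lam0 pr; rewrite fin_numE rNy/= -(fineK rx0).
by case: (r (prox _ _ _)) => //=; rewrite leye_eq.
Qed.

(** First-order optimality: the minimizer [w] is compared with t y + (1 - t) w, the inequality is
    divided by t, and t tends to 0. *)
Lemma prox_vi (lam : R) r v y : 0 < lam -> proper_convex_lsc r ->
  r y \is a fin_num ->
  lam * (fine (r (prox lam r v)) - fine (r y)) <=
  dotv (v - prox lam r v) (prox lam r v - y).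
Proof.
move=> lam0 pr ry; have rw := prox_fin_num v lam0 pr.
have := prox_argmin v lam0 pr; set w := prox lam r v in rw * => wmin.
have [[rNy _] cr _] := pr.
set X := _ * _; set Y := dotv _ _.
suff h (t : R) : 0 < t -> t <= 1 -> X - Y <= t * (enorm (w - y) ^+ 2 / 2).
  rewrite -subr_le0 leNgt; apply/negP => XY0.
  have Z0 : 0 <= enorm (w - y) ^+ 2 / 2 by rewrite divr_ge0// sqr_ge0.
  (* If X - Y were positive, this t would give t Z < X - Y. *)
  set Z := _ / 2 in h Z0; pose t := Num.min 1 ((X - Y) / (Z + 1) / 2).
  have Z1 : 0 < Z + 1 by lra.
  have t0 : 0 < t by rewrite lt_min ltr01/= !divr_gt0.
  have t1 : t <= 1 by rewrite ge_min lexx.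
  have := h t t0 t1.
  have : t <= (X - Y) / (Z + 1) / 2 by rewrite ge_min lexx orbT.
  rewrite -mulrA -invfM ler_pdivlMr ?mulr_gt0//; nra.
move=> t0 t1.
have := le_trans (wmin (t *: y + (1 - t) *: w))
  (leeD2r _ (cr y w t (ltW t0) t1)).
rewrite -(fineK rw) -(fineK ry) -!EFinM -!EFinD lee_fin !enorm_sqr.
have -> : t *: y + (1 - t) *: w - v = (w - v) - t *: (w - y).
  by apply/rowP => i; rewrite !mxE; ring.
rewrite /X /Y -(opprB w v); move: (w - v) (w - y) => p q; rewrite !dotvE.
rewrite (dotvC q p) => h.
set a := fine _ in h *; set b := fine (r y) in h *.
have {}h : 2 * lam * (a + (2 * lam)^-1 * dotv p p) <=
    2 * lam * (t * b + (1 - t) * a + (2 * lam)^-1 *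
      (dotv p p - t * dotv p q - (t * dotv p q - t * (t * dotv q q)))).
  rewrite ler_pM2l ?mulr_gt0//; apply: le_trans h _.
  by rewrite le_eqVlt; apply/orP; left; apply/eqP; ring.
have lam2 : 2 * lam != 0 by rewrite gt_eqF// mulr_gt0.
rewrite !(mulrDr (2 * lam)) !(mulrA (2 * lam) (2 * lam)^-1) in h.
rewrite !divff// !mul1r in h.
rewrite -(ler_pM2l t0); nra.
Qed.

(** Adding the variational inequalities of the two proximal points, each tested at the other,
    cancels [r]. *)
Lemma prox_nonexpansive (lam : R) r u v : 0 < lam -> proper_convex_lsc r ->
  enorm (prox lam r u - prox lam r v) <= enorm (u - v).
Proof.
move=> lam0 pr.
have := prox_vi u lam0 pr (prox_fin_num v lam0 pr).
have := prox_vi v lam0 pr (prox_fin_num u lam0 pr).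
move: (prox lam r u) (prox lam r v) => p q h1 h2.
have h : dotv (p - q) (p - q) <= dotv (u - v) (p - q).
  move: h1 h2; rewrite !dotvE (dotvC q p); lra.
have := le_trans h (cauchy_schwarz _ _).
rewrite -enorm_sqr expr2 => {}h.
have [d0|d0] := ltP 0 (enorm (p - q)); last exact: le_trans d0 (enorm_ge0 _).
by rewrite -(ler_pM2r d0).
Qed.

End prox.

(** * Independence and square-integrable noise *)

Section borel_vectors.
Context {R : realType} {m : nat}.

Lemma measurable_rV_coord i :
  measurable_fun setT (fun x : borel_rV R m => (x : 'rV[R]_m) 0 i).
Proof.
apply: (measurability _ (RGenOpens.measurableE R)).
move=> _ [_ [a [b ->]] <-]; rewrite setTI; apply: sub_sigma_algebra => /=.
apply: open_comp; last exact: interval_open.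
by move=> x _; exact: coord_continuous.
Qed.

(** Open sets are therefore countable unions of rational boxes, so that measurability into
    [borel_rV] can be checked on coordinates. *)
Lemma rat_box (A : set 'rV[R]_m) x : open A -> A x ->
  exists q : 'rV[rat]_m * 'rV[rat]_m,
    (forall i, ratr (q.1 0 i) < x 0 i < ratr (q.2 0 i)) /\
    [set y : 'rV[R]_m | forall i, ratr (q.1 0 i) < y 0 i < ratr (q.2 0 i)]
      `<=` A.
Proof.
move=> oA Ax; have /nbhs_ballP[e /= e0 eA] := open_nbhs_nbhs (conj oA Ax).
have lo i : {q : rat | x 0 i - e < ratr q < x 0 i}.
  apply: cid; have [|q] := @rat_in_itvoo R (x 0 i - e) (x 0 i).
    by rewrite ltrBlDr ltrDl.
  by rewrite in_itv/=; exists q.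
have hi i : {q : rat | x 0 i < ratr q < x 0 i + e}.
  apply: cid; have [|q] := @rat_in_itvoo R (x 0 i) (x 0 i + e).
    by rewrite ltrDl.
  by rewrite in_itv/=; exists q.
exists (\row_i sval (lo i), \row_i sval (hi i)); split => [i|y /= qy].
  by rewrite !mxE; case: (lo i) (hi i) => [? /= /andP[_ ->]] [? /= /andP[->]].
apply: eA; split => // j i; rewrite ord1.
have := qy i; rewrite !mxE; case: (lo i) (hi i) => [? /= /andP[+ _]] [? /= /andP[_ +]].
by move=> h1 h2 /andP[h3 h4]; rewrite /ball/= ltr_norml; apply/andP; split; lra.
Qed.

Lemma measurable_fun_rV d (T : measurableType d) (f : T -> 'rV[R]_m) :
  (forall i, measurable_fun setT (fun t => f t 0 i)) ->
  measurable_fun setT (f : T -> borel_rV R m).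
Proof.
move=> mf; apply: (@measurability _ _ T (borel_rV R m) setT f
  [set A : set 'rV[R]_m | open A]) => //.
move=> _ [A oA <-]; rewrite setTI.
pose box (q : 'rV[rat]_m * 'rV[rat]_m) := [set y : 'rV[R]_m |
  forall i, ratr (q.1 0 i) < y 0 i < ratr (q.2 0 i)].
rewrite (_ : f @^-1` A = \bigcup_(q in [set q | box q `<=` A])
    \bigcap_(i in [set: 'I_m])
      (fun t => f t 0 i) @^-1` `](ratr (q.1 0 i)), (ratr (q.2 0 i))[%classic); last first.
  apply/seteqP; split => [t /= At|t [q /= qA qt]].
    have [q [qt qA]] := rat_box oA At; exists q => // i _ /=.
    by rewrite in_itv/= qt.
  by apply: qA => i; have := qt i I; rewrite /= in_itv.
rewrite bigcup_mkcond; apply: countable_bigcupT_measurable => [|q].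
  exact: countableP.
case: ifPn => // _; apply: fin_bigcap_measurable => // i _.
by rewrite -[X in measurable X]setTI; apply: mf.
Qed.

Section combinations.
Context d {T : measurableType d}.
Implicit Types f g : T -> 'rV[R]_m.

Lemma measurable_coord f i : measurable_fun setT (f : T -> borel_rV R m) ->
  measurable_fun setT (fun t => f t 0 i).
Proof.
move=> mf.
exact: (measurableT_comp (measurable_rV_coord i) mf).
Qed.

Lemma measurable_rVD f g :
  measurable_fun setT (f : T -> borel_rV R m) ->
  measurable_fun setT (g : T -> borel_rV R m) ->
  measurable_fun setT ((fun t => f t + g t) : T -> borel_rV R m).
Proof.
move=> mf mg; apply: measurable_fun_rV => i.
under eq_fun do rewrite mxE.
by apply: measurable_funD; exact: measurable_coord.
Qed.

Lemma measurable_rVZ (c : R) f :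
  measurable_fun setT (f : T -> borel_rV R m) ->
  measurable_fun setT ((fun t => c *: f t) : T -> borel_rV R m).
Proof.
move=> mf; apply: measurable_fun_rV => i.
under eq_fun do rewrite mxE.
by apply: measurable_funM => //; exact: measurable_coord.
Qed.

Lemma measurable_rVB f g :
  measurable_fun setT (f : T -> borel_rV R m) ->
  measurable_fun setT (g : T -> borel_rV R m) ->
  measurable_fun setT ((fun t => f t - g t) : T -> borel_rV R m).
Proof.
move=> mf mg; rewrite (_ : (fun t => _) = fun t => f t + (-1) *: g t).
  by apply: measurable_rVD => //; exact: measurable_rVZ.
by apply/funext => t; rewrite scaleN1r.
Qed.

Lemma measurable_dotv f g :
  measurable_fun setT (f : T -> borel_rV R m) ->
  measurable_fun setT (g : T -> borel_rV R m) ->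
  measurable_fun setT (fun t => dotv (f t) (g t)).
Proof.
move=> mf mg; apply: measurable_sum => i.
by apply: measurable_funM; exact: measurable_coord.
Qed.

End combinations.

(** The Lipschitz bound uses the Euclidean norm and the topology the sup norm; continuity of the
    squared Euclidean distance links the two. *)
Lemma lipschitz_op_continuous (c : R) (phi : 'rV[R]_m -> 'rV[R]_m) i :
  lipschitz_op c phi -> continuous (fun x => phi x 0 i).
Proof.
move=> cphi x; have FF : Filter (nbhs x) := nbhs_filter x.
apply/(@cvgrPdist_lt _ _ _ _ FF) => e e0.
pose k := c ^+ 2 + 1; have k0 : 0 < k by rewrite ltr_wpDl// sqr_ge0.
have : \forall y \near x, k * enorm (y - x) ^+ 2 < e ^+ 2.
  pose q (y : 'rV[R]_m) := k * enorm (y - x) ^+ 2.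
  have cq : continuous q := @continuous_dist_sqr R m x k.
  apply: (cvgr_lt (q x) (cq x)).
  by rewrite /q subrr enorm0 expr0n mulr0 exprn_gt0.
move=> near_x; near=> y.
have yx : k * enorm (y - x) ^+ 2 < e ^+ 2 by near: y.
apply: (@le_lt_trans _ _ (enorm (phi x - phi y))).
  by have := coord_le_enorm (phi x - phi y) i; rewrite !mxE.
rewrite -(@ltr_pXn2r _ 2)// ?nnegrE ?enorm_ge0 ?(ltW e0)//.
apply: le_lt_trans yx; have := cphi x y; rewrite (enormB x) => h.
have : enorm (phi x - phi y) ^+ 2 <= (c * enorm (y - x)) ^+ 2.
  rewrite lerXn2r// ?nnegrE ?enorm_ge0//.
  exact: le_trans (enorm_ge0 _) h.
have := sqr_ge0 (enorm (y - x)); rewrite exprMn /k; nra.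
Unshelve. all: by end_near. Qed.

Lemma measurable_lipschitz d (T : measurableType d) (c : R) phi
    (f : T -> 'rV[R]_m) : lipschitz_op c phi ->
  measurable_fun setT (f : T -> borel_rV R m) ->
  measurable_fun setT ((fun t => phi (f t)) : T -> borel_rV R m).
Proof.
move=> cphi mf; apply: measurable_fun_rV => i.
suff mphi : measurable_fun setT ((fun x => phi x 0 i) : borel_rV R m -> R).
  exact: (measurableT_comp mphi mf).
apply: (measurability _ (RGenOpens.measurableE R)).
move=> _ [_ [a [b ->]] <-]; rewrite setTI; apply: sub_sigma_algebra => /=.
rewrite -[_ @^-1` _]/((fun x : 'rV[R]_m => phi x 0 i) @^-1` `]a, b[%classic).
apply: open_comp; last exact: interval_open.
by move=> x _; exact: (lipschitz_op_continuous cphi).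
Qed.

End borel_vectors.

(** * Integration against the joint law of two independent variables *)

Section independent_pair.
Context d d1 d2 (Om : measurableType d) (T1 : measurableType d1)
  (T2 : measurableType d2) (R : realType) (P : probability Om R).
Variables (V : {mfun Om >-> T1}) (X : {mfun Om >-> T2}).
Hypothesis VX : independent_rv P V X.

Let pair_mfun : {mfun Om >-> (T1 * T2)%type} := mfun_Sub
  (mem_set (measurable_fun_pair (@measurable_funP _ _ _ _ setT V)
                                (@measurable_funP _ _ _ _ setT X))).

Lemma distribution_pair A : measurable A ->
  (distribution P V \x distribution P X)%E A = distribution P pair_mfun A.
Proof.
apply: product_measure_unique => B C mB mC.
by rewrite -[RHS]VX.
Qed.

Lemma ge0_integral_pair (h : T1 * T2 -> \bar R) :
  measurable_fun setT h -> (forall u, 0 <= h u)%E ->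
  (\int[P]_t h (V t, X t) =
   \int[distribution P V]_v \int[distribution P X]_s h (v, s))%E.
Proof.
move=> mh h0; transitivity (\int[distribution P pair_mfun]_u h u)%E.
  by rewrite ge0_integral_distribution.
rewrite (eq_measure_integral (distribution P V \x distribution P X)%E); last first.
  by move=> A mA _; apply/esym/distribution_pair.
by rewrite fubini_tonelli1.
Qed.

Lemma integral_pair (h : T1 * T2 -> \bar R) :
  measurable_fun setT h ->
  P.-integrable setT (fun t => h (V t, X t)) ->
  (\int[P]_t h (V t, X t) =
   \int[distribution P V]_v \int[distribution P X]_s h (v, s))%E.
Proof.
move=> mh ih; transitivity (\int[distribution P pair_mfun]_u h u)%E.
  by rewrite integral_distribution.
rewrite (eq_measure_integral (distribution P V \x distribution P X)%E); last first.
  by move=> A mA _; apply/esym/distribution_pair.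
rewrite -integral12_prod_meas1//.
(* Fubini needs integrability under the product law, which is obtained from that under [P] through
   the joint law. *)
have : (distribution P pair_mfun).-integrable setT h.
  exact: integrable_pushforward.
move=> /integrableP[_ hoo]; apply/integrableP; split => //.
apply: le_lt_trans hoo; rewrite le_eqVlt; apply/orP; left; apply/eqP.
by apply: eq_measure_integral => A mA _; exact: distribution_pair.
Qed.

End independent_pair.

(** * The sigma-algebra of the samples drawn so far *)

Section past.
Context d d' (Om : measurableType d) (Xi : measurableType d') (R : realType)
  (P : probability Om R) (I : choiceType) (X : I -> {mfun Om >-> Xi}).

(* A generating pi-system of the sigma-algebra of the samples X i, i \in s. *)
Definition past (s : seq I) : set (set Om) :=
  [set A | exists2 C : I -> set Xi, (forall i, measurable (C i)) &
     A = \bigcap_(i in [set` s]) (X i @^-1` C i)].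

(** As a type of its own, [Om] with the smaller sigma-algebra turns adaptedness into ordinary
    measurability. *)
Definition pastT (s : seq I) := g_sigma_algebraType (past s).

Lemma past_measurable s : past s `<=` measurable.
Proof.
move=> _ [C mC ->]; apply: fin_bigcap_measurable => [|i _].
  exact: finite_seq.
by rewrite -[X in measurable X]setTI; apply: measurable_funP.
Qed.

Lemma pastT_measurable s (A : set Om) : measurable (A : set (pastT s)) ->
  measurable A.
Proof.
apply: smallest_sub; first exact: sigma_algebra_measurable.
exact: past_measurable.
Qed.

Lemma pastW s s' : {subset s <= s'} ->
  forall A : set Om, measurable (A : set (pastT s)) ->
  measurable (A : set (pastT s')).
Proof.
move=> ss'; apply: smallest_sub; first exact: smallest_sigma_algebra.
move=> _ [C mC ->]; apply: sub_sigma_algebra.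
exists (fun i => if i \in s then C i else setT) => [i|].
  by case: ifP.
apply/seteqP; split => [t st i /= _|t st i /= si].
  by case: ifPn => // si; exact: st.
by have := st i (ss' _ si); rewrite /= si.
Qed.

Lemma past_sample s i : i \in s -> measurable_fun setT (X i : pastT s -> Xi).
Proof.
move=> si _ C mC; rewrite setTI; apply: sub_sigma_algebra.
exists (fun j => if j == i then C else setT) => [j|]; first by case: ifP.
apply/seteqP; split => [t Ct j /= _|t /(_ i si)/=]; last by rewrite eqxx.
by case: ifPn => // /eqP ->.
Qed.

Lemma past_fun_measurable s d2 (T : measurableType d2) (f : Om -> T) :
  measurable_fun setT (f : pastT s -> T) -> measurable_fun setT f.
Proof.
move=> mf _ C mC; rewrite setTI; apply: (@pastT_measurable s).
by rewrite -[X in measurable X]setTI; exact: mf.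
Qed.

Lemma past_funW s s' d2 (T : measurableType d2) (f : Om -> T) :
  {subset s <= s'} ->
  measurable_fun setT (f : pastT s -> T) ->
  measurable_fun setT (f : pastT s' -> T).
Proof.
move=> ss' mf _ C mC; rewrite setTI; apply: (pastW ss').
by rewrite -[X in measurable X]setTI; exact: mf.
Qed.

(** The whole past as a single random variable, to which the results on independent pairs apply. *)
Definition past_id (s : seq I) : {mfun Om >-> pastT s} := mfun_Sub
  (mem_set (@past_fun_measurable s _ (pastT s) id (@measurable_id _ (pastT s) setT))).

Variable Q : probability Xi R.
Hypothesis drawn : drawn_from P Q X.

(** For a fixed event E of the sample [j], the finite measures A -> P (A and E) and A -> P E * P A
    agree on the pi-system [past s] by mutual independence, hence on the sigma-algebra it
    generates. *)
Lemma past_independent s j : uniq s -> j \notin s ->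
  independent_rv P (past_id s) (X j).
Proof.
move=> us js A C mA mC.
have mE : measurable (X j @^-1` C).
  by rewrite -[X in measurable X]setTI; apply: measurable_funP.
have PE : P (X j @^-1` C) = (fine (P (X j @^-1` C)))%:E.
  by rewrite fineK// fin_num_measure.
pose r : {nonneg R} := NngNum (fine_ge0 (measure_ge0 P (X j @^-1` C))).
rewrite muleC PE -[LHS]/(mrestr P mE A) -[RHS]/(mscale r P A).
apply: (@g_sigma_algebra_measure_unique _ _ _ (past s) _ (fun=> setT)) => //.
- exact: past_measurable.
- move=> _; exists (fun=> setT) => //.
  by apply/seteqP; split.
- by rewrite bigcup_const.
- move=> _ _ [D mD ->] [D' mD' ->].
  exists (fun i => D i `&` D' i) => [i|]; first exact: measurableI.
  by rewrite -bigcapI.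
- move=> _ [D mD ->]; rewrite /mrestr/= /mscale/= -PE muleC.
  have [_ indep] := drawn.
  pose D' i := if i == j then C else D i.
  have mD' i : measurable (D' i) by rewrite /D'; case: ifP.
  have := indep (j :: s) D'; rewrite /= js us => /(_ erefl mD').
  rewrite big_cons {2}/D' eqxx [X in _ = (_ * X)%E](_ : _ =
      P (\bigcap_(i in [set` s]) X i @^-1` D i)); last first.
    rewrite indep// big_seq [RHS]big_seq; apply: eq_bigr => i si.
    by rewrite /D'; case: eqP => // ij; rewrite ij (negPf js) in si.
  rewrite muleC => <-; congr (P _); apply/seteqP; split => t.
    move=> [Dt Ct] i /=; rewrite inE /D'; case: eqVneq => [-> //|_/= si].
    exact: Dt.
  move=> Dt; split => [i /= si|].
    have := Dt i; rewrite /= inE si orbT /D' => /(_ isT).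
    by case: eqP => // ij; rewrite ij (negPf js) in si.
  by have := Dt j; rewrite /= inE eqxx /D' eqxx => /(_ isT).
- by move=> _; rewrite /mrestr ltey_eq fin_num_measure//; exact: measurableI.
Qed.

End past.

(** * Real-valued expectations and square-integrable vectors *)

Section expectation.
Context d {Om : measurableType d} {R : realType} (P : probability Om R).
Implicit Types (f g : Om -> R) (c : R).

Definition L1 f := P.-integrable setT (EFin \o f).
Definition E f : R := Rintegral P setT f.

Lemma L1_cst c : L1 (fun=> c).
Proof. exact: finite_measure_integrable_cst. Qed.

Lemma L1D f g : L1 f -> L1 g -> L1 (fun t => f t + g t).
Proof. by move=> Lf Lg; exact: (integrableD measurableT Lf Lg). Qed.

Lemma L1Z c f : L1 f -> L1 (fun t => c * f t).
Proof. by move=> Lf; exact: (integrableZl measurableT c Lf). Qed.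

Lemma L1N f : L1 f -> L1 (fun t => - f t).
Proof. by move=> /(L1Z (-1)); under eq_fun do rewrite mulN1r. Qed.

Lemma L1B f g : L1 f -> L1 g -> L1 (fun t => f t - g t).
Proof. by move=> ? ?; apply: L1D => //; exact: L1N. Qed.

Lemma L1_sum (I : Type) (s : seq I) (f : I -> Om -> R) :
  (forall i, L1 (f i)) -> L1 (fun t => \sum_(i <- s) f i t).
Proof.
move=> Lf; elim: s => [|i s ih].
  by under eq_fun do rewrite big_nil; exact: L1_cst.
by under eq_fun do rewrite big_cons; exact: L1D.
Qed.

Lemma L1_le f g : measurable_fun setT f -> (forall t, `|f t| <= g t) ->
  L1 g -> L1 f.
Proof.
move=> mf fg; apply: le_integrable => //; first exact/measurable_EFinP.
by move=> t _; rewrite /= lee_fin (le_trans (fg t))// ler_norm.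
Qed.

Lemma E_cst c : E (fun=> c) = c.
Proof. by rewrite /E Rintegral_cst//= probability_setT mulr1. Qed.

Lemma ED f g : L1 f -> L1 g -> E (fun t => f t + g t) = E f + E g.
Proof. by move=> ? ?; exact: RintegralD. Qed.

Lemma EB f g : L1 f -> L1 g -> E (fun t => f t - g t) = E f - E g.
Proof. by move=> ? ?; exact: RintegralB. Qed.

Lemma EZ c f : L1 f -> E (fun t => c * f t) = c * E f.
Proof. by move=> ?; exact: RintegralZl. Qed.

Lemma E_sum (I : Type) (s : seq I) (f : I -> Om -> R) :
  (forall i, L1 (f i)) ->
  E (fun t => \sum_(i <- s) f i t) = \sum_(i <- s) E (f i).
Proof.
move=> Lf; elim: s => [|i s ih].
  by under eq_fun do rewrite big_nil; rewrite E_cst big_nil.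
under eq_fun do rewrite big_cons.
by rewrite ED ?big_cons ?ih//; exact: L1_sum.
Qed.

Lemma E_le f g : L1 f -> L1 g -> (forall t, f t <= g t) -> E f <= E g.
Proof. by move=> ? ? fg; apply: le_Rintegral => // t _. Qed.

Lemma E_ge0 f : (forall t, 0 <= f t) -> 0 <= E f.
Proof. by move=> f0; apply: Rintegral_ge0 => t _. Qed.

Lemma E_EFin f : L1 f -> (E f)%:E = (\int[P]_t (f t)%:E)%E.
Proof. by move=> ?; rewrite /E /Rintegral fineK//; exact: integrable_fin_num. Qed.

End expectation.

Section square_integrable.
Context d {Om : measurableType d} {R : realType} (P : probability Om R) {m : nat}.
Implicit Types (f g : Om -> 'rV[R]_m) (c : R).

Definition L2 f := measurable_fun setT (f : Om -> borel_rV R m) /\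
  L1 P (fun t => dotv (f t) (f t)).

Lemma L2_le f (g : Om -> R) :
  measurable_fun setT (f : Om -> borel_rV R m) ->
  (forall t, dotv (f t) (f t) <= g t) -> L1 P g -> L2 f.
Proof.
move=> mf fg Lg; split => //; apply: L1_le Lg; first exact: measurable_dotv.
by move=> t; rewrite ger0_norm// dotv_ge0.
Qed.

Lemma L2_cst (x : 'rV[R]_m) : L2 (fun=> x).
Proof. by split; [exact: measurable_cst|exact: L1_cst]. Qed.

Lemma L2Z c f : L2 f -> L2 (fun t => c *: f t).
Proof.
move=> [mf Lf]; split; first exact: measurable_rVZ.
by under eq_fun do rewrite dotvZl dotvZr; do 2 apply: L1Z.
Qed.

Lemma L2D f g : L2 f -> L2 g -> L2 (fun t => f t + g t).
Proof.
move=> [mf Lf] [mg Lg].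
apply: (@L2_le _ (fun t => 2 * dotv (f t) (f t) + 2 * dotv (g t) (g t))).
- exact: measurable_rVD.
- move=> t; have := dotv_ge0 (f t - g t); rewrite !dotvE (dotvC (g t) (f t)).
  lra.
- by apply: L1D; exact: L1Z.
Qed.

Lemma L2B f g : L2 f -> L2 g -> L2 (fun t => f t - g t).
Proof.
move=> Lf /(L2Z (-1)) Lg; have := L2D Lf Lg.
by under eq_fun do rewrite scaleN1r.
Qed.

Lemma L2_sum (I : Type) (s : seq I) (f : I -> Om -> 'rV[R]_m) :
  (forall i, L2 (f i)) -> L2 (fun t => \sum_(i <- s) f i t).
Proof.
move=> Lf; elim: s => [|i s ih].
  by under eq_fun do rewrite big_nil; exact: L2_cst.
by under eq_fun do rewrite big_cons; exact: L2D.
Qed.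

Lemma L2_lipschitz c (phi : 'rV[R]_m -> 'rV[R]_m) f : lipschitz_op c phi ->
  L2 f -> L2 (fun t => phi (f t)).
Proof.
move=> cphi [mf Lf].
apply: (@L2_le _ (fun t =>
  2 * c ^+ 2 * dotv (f t) (f t) + 2 * dotv (phi 0) (phi 0))).
- exact: measurable_lipschitz cphi mf.
- move=> t; have := cphi (f t) 0; rewrite subr0 => h.
  have : enorm (phi (f t) - phi 0) ^+ 2 <= (c * enorm (f t)) ^+ 2.
    by rewrite lerXn2r// ?nnegrE ?enorm_ge0// (le_trans (enorm_ge0 _) h).
  rewrite exprMn !enorm_sqr.
  by have := dotv_le_sub (phi (f t)) (phi 0); lra.
- by apply: L1D; [exact: L1Z|exact: L1_cst].
Qed.

Lemma L1_dotv f g : L2 f -> L2 g -> L1 P (fun t => dotv (f t) (g t)).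
Proof.
move=> [mf Lf] [mg Lg].
apply: (@L1_le _ _ _ _ _ (fun t => dotv (f t) (f t) + dotv (g t) (g t))).
- exact: measurable_dotv.
- move=> t; have := dotv_ge0 (f t + g t); have := dotv_ge0 (f t - g t).
  have := dotv_ge0 (f t); have := dotv_ge0 (g t).
  rewrite !dotvE (dotvC (g t) (f t)) ler_norml => *; apply/andP; split; lra.
- exact: L1D.
Qed.

End square_integrable.

(** * Noise of the estimator at a point determined by the past *)

Section noise.
Context d1 d2 d' (Om : measurableType d1) (T : measurableType d2)
  (Xi : measurableType d') (R : realType) (P : probability Om R)
  (Q : probability Xi R) (m : nat) (sigma L : R)
  (F : 'rV[R]_m -> 'rV[R]_m) (Fs : 'rV[R]_m -> Xi -> 'rV[R]_m).
Hypothesis Fs_est : stochastic_estimator Q sigma F Fs.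
Hypothesis F_lip : lipschitz_op L F.

Definition noise (w : 'rV[R]_m) (s : Xi) : 'rV[R]_m := Fs w s - F w.

Lemma measurable_noise d3 (S : measurableType d3) (u : S -> 'rV[R]_m)
    (v : S -> Xi) :
  measurable_fun setT (u : S -> borel_rV R m) -> measurable_fun setT v ->
  measurable_fun setT ((fun t => noise (u t) (v t)) : S -> borel_rV R m).
Proof.
move=> mu mv; apply: measurable_rVB; last exact: measurable_lipschitz F_lip mu.
apply: measurable_fun_rV => i; have [mFs _ _] := Fs_est.
exact: (measurableT_comp (mFs i) (measurable_fun_pair mu mv)).
Qed.

(** The variance bound controls the first moment, since a coordinate is at most 1 plus the squared
    norm. *)
Lemma integrable_noise w i : Q.-integrable setT (fun s => (noise w s 0 i)%:E).
Proof.
have mn : measurable_fun setT ((fun s => noise w s) : Xi -> borel_rV R m).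
  by apply: measurable_noise => //; exact: measurable_cst.
suff [_ Ln] : L2 Q (fun s => noise w s).
  apply: (@L1_le _ _ _ Q _ (fun s => 1 + dotv (noise w s) (noise w s))).
  - exact: measurable_coord.
  - move=> s; have h := coord_le_enorm (noise w s) i; apply: le_trans h _.
    rewrite -enorm_sqr; have := enorm_ge0 (noise w s); nra.
  - by apply: L1D => //; exact: L1_cst.
split => //; apply/integrableP; split.
  by apply/measurable_EFinP; exact: measurable_dotv.
have [_ _ /(_ w)] := Fs_est; rewrite unlock => hv.
apply: le_lt_trans (ltry (sigma ^+ 2)); apply: le_trans hv.
rewrite le_eqVlt; apply/orP; left; apply/eqP; apply: eq_integral => s _ /=.
by rewrite ger0_norm ?dotv_ge0// enorm_sqr.
Qed.

Lemma integral_noise w i : (\int[Q]_s (noise w s 0 i)%:E = 0)%E.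
Proof.
have [_ /(_ w i) + _] := Fs_est; rewrite unlock => hm.
have Li := integrable_noise w i.
have LF : Q.-integrable setT (fun s => (Fs w s 0 i)%:E).
  have := integrableD measurableT Li (@L1_cst _ _ _ Q (F w 0 i)).
  apply: eq_integrable => // s _ /=.
  by rewrite !mxE -EFinD subrK.
transitivity (\int[Q]_s ((Fs w s 0 i)%:E - (F w 0 i)%:E))%E.
  by apply: eq_integral => s _; rewrite /noise !mxE EFinB.
rewrite integralB//; last exact: L1_cst.
by rewrite hm integral_cst//= probability_setT mule1 subee.
Qed.

Variables (V : {mfun Om >-> T}) (X : {mfun Om >-> Xi}) (u : T -> 'rV[R]_m).
Hypothesis VX : independent_rv P V X.
Hypothesis XQ : forall A, measurable A -> distribution P X A = Q A.
Hypothesis mu : measurable_fun setT (u : T -> borel_rV R m).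

(** The past [V] decides where the estimator is evaluated, and the fresh sample [X] is independent
    of it. *)
Let n t := noise (u (V t)) (X t).

Let mnTX : measurable_fun setT
  ((fun p : T * Xi => noise (u p.1) p.2) : _ -> borel_rV R m).
Proof.
apply: measurable_noise; last exact: measurable_snd.
exact: (measurableT_comp mu measurable_fst).
Qed.

Let mn : measurable_fun setT (n : Om -> borel_rV R m).
Proof.
apply: measurable_noise; last exact: measurable_funP.
exact: (measurableT_comp mu (@measurable_funP _ _ _ _ setT V)).
Qed.

Let noise_sqr_le : (\int[P]_t (dotv (n t) (n t))%:E <= (sigma ^+ 2)%:E)%E.
Proof.
rewrite (ge0_integral_pair VX
  (h := fun p => (dotv (noise (u p.1) p.2) (noise (u p.1) p.2))%:E)); last 2 first.
- by apply/measurable_EFinP; exact: measurable_dotv.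
- by move=> p; rewrite lee_fin dotv_ge0.
rewrite -[leRHS]mule1 -(probability_setT (distribution P V)) -integral_cst//.
apply: ge0_le_integral => //.
- by move=> v _; apply: integral_ge0 => s _; rewrite lee_fin dotv_ge0.
- apply: (@measurable_fun_fubini_tonelli_F _ _ _ _ _ _
    (fun p => (dotv (noise (u p.1) p.2) (noise (u p.1) p.2))%:E)).
  + by apply/measurable_EFinP; exact: measurable_dotv.
  + by move=> p; rewrite lee_fin dotv_ge0.
move=> v _; rewrite (eq_measure_integral Q); last by move=> A mA _; exact: XQ.
have [_ _ /(_ (u v))] := Fs_est; rewrite unlock; apply: le_trans.
rewrite le_eqVlt; apply/orP; left; apply/eqP; apply: eq_integral => s _ /=.
by rewrite enorm_sqr.
Qed.

Lemma noise_L2 : L2 P n.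
Proof.
split => //; apply/integrableP; split.
  by apply/measurable_EFinP; exact: measurable_dotv.
apply: le_lt_trans (ltry (sigma ^+ 2)); apply: le_trans noise_sqr_le.
rewrite le_eqVlt; apply/orP; left; apply/eqP; apply: eq_integral => s _ /=.
by rewrite ger0_norm ?dotv_ge0.
Qed.

Lemma E_noise_sqr : E P (fun t => dotv (n t) (n t)) <= sigma ^+ 2.
Proof. by rewrite -lee_fin E_EFin//; have [_] := noise_L2. Qed.

(** By Fubini the past can be frozen; then [y] is a constant and unbiasedness annihilates the inner
    integral coordinate by coordinate. *)
Lemma E_noise_orth (y : T -> 'rV[R]_m) :
  measurable_fun setT (y : T -> borel_rV R m) -> L2 P (fun t => y (V t)) ->
  E P (fun t => dotv (n t) (y (V t))) = 0.
Proof.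
move=> my Ly; rewrite /E /Rintegral.
rewrite (integral_pair VX (h := fun p => (dotv (noise (u p.1) p.2) (y p.1))%:E)); last 2 first.
- apply/measurable_EFinP; apply: measurable_dotv => //.
  exact: (measurableT_comp my measurable_fst).
- exact: (L1_dotv noise_L2 Ly).
rewrite integral0_eq// => v _.
rewrite (eq_measure_integral Q); last by move=> A mA _; exact: XQ.
under eq_integral do rewrite /dotv -sumEFin.
rewrite integral_sum//=; last first.
  move=> i; under eq_fun do rewrite mulrC EFinM.
  by apply: integrableZl => //; exact: integrable_noise.
rewrite big1// => i _; under eq_integral do rewrite mulrC EFinM.
by rewrite integralZl ?integral_noise ?mule0//; exact: integrable_noise.
Qed.

End noise.

(** * The noisy run against the noise-free run *)

(** Descends along the integrand: an inner product is integrable when both factors are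
    square-integrable, and linear combinations reduce to their terms. *)
Ltac integ := repeat match goal with
  | H : forall k, L2 _ (?f k) |- L2 _ (?f _) => exact: H
  | H : forall k, L2 _ (?f k) |- L2 _ (fun t => ?f ?k t) => exact: (H k)
  | H : L2 _ ?f |- L2 _ ?f => exact: H
  | H : L2 _ ?f |- L2 _ (fun t => ?f t) => exact: H
  | H : forall k, L2 _ (fun t => ?f (?x k t))
      |- L2 _ (fun t => ?f (?x ?k t)) => exact: (H k)
  | |- is_true (L1 _ (fun t => dotv (@?f t) (@?g t))) =>
      apply: (@L1_dotv _ _ _ _ _ f g)
  | |- is_true (L1 _ (fun t => @?f t - @?g t)) => apply: (@L1B _ _ _ _ f g)
  | |- is_true (L1 _ (fun t => @?f t + @?g t)) => apply: (@L1D _ _ _ _ f g)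
  | |- is_true (L1 _ (fun t => ?c * @?f t)) => apply: (@L1Z _ _ _ _ c f)
  | |- L2 _ (fun t => @?f t - @?g t) => apply: (@L2B _ _ _ _ _ f g)
  | |- L2 _ (fun t => @?f t + @?g t) => apply: (@L2D _ _ _ _ _ f g)
  | |- L2 _ (fun t => ?c *: @?f t) => apply: (@L2Z _ _ _ _ _ c f)
  | |- L2 _ (fun t => ?x) => exact: L2_cst
  | |- is_true (L1 _ _) => apply: L1_sum => ?
  | |- L2 _ _ => apply: L2_sum => ?
  end.

Section core.
Context d {Om : measurableType d} {R : realType} (P : probability Om R) {m : nat}.
Variables (F : 'rV[R]_m -> 'rV[R]_m) (r : 'rV[R]_m -> \bar R) (L sigma : R).
Variables (alpha : nat -> R) (z0 : 'rV[R]_m).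
(* Primes denote the noise-free run, and [w0 k] is what [w k] would be without
   the noise [e k]. *)
Variables (z w dia w0 e eps : nat -> Om -> 'rV[R]_m).
Variables (z' w' dia' : nat -> 'rV[R]_m).
Hypotheses (L0 : 0 < L) (monoF : monotone_op F) (lipF : lipschitz_op L F)
  (pr : proper_convex_lsc r) (al0 : forall k, 0 < alpha k).
Hypothesis wE : forall k t,
  w k t = prox (alpha k) r (z k t - alpha k *: (F (dia k t) + e k t)).
Hypothesis zE : forall k t, z k.+1 t =
  w k t + alpha k *: ((F (dia k t) + e k t) - (F (w k t) + eps k t)).
Hypothesis z0E : forall t, z 0 t = z0.
Hypothesis wE' : forall k,
  w' k = prox (alpha k) r (z' k - alpha k *: F (dia' k)).
Hypothesis zE' : forall k, z' k.+1 = w' k + alpha k *: (F (dia' k) - F (w' k)).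
Hypothesis z0E' : z' 0 = z0.
Hypotheses (Lz : forall k, L2 P (z k)) (Lw : forall k, L2 P (w k))
  (Ldia : forall k, L2 P (dia k)) (Lw0 : forall k, L2 P (w0 k))
  (Le : forall k, L2 P (e k)) (Leps : forall k, L2 P (eps k)).
Hypothesis e_var : forall k, E P (fun t => dotv (e k t) (e k t)) <= sigma ^+ 2.
Hypothesis eps_var : forall k,
  E P (fun t => dotv (eps k t) (eps k t)) <= sigma ^+ 2.

Let S k t := \sum_(j < k) alpha j *: eps j t.

(** These orthogonality relations and [w0_close] are all that the estimates below use of the
    freshness of the samples. There is none between [e k] and [w k], hence the detour through
    [w0 k]. *)
Hypothesis e_cst : forall k x, E P (fun t => dotv (e k t) x) = 0.
Hypothesis e_dia : forall k, E P (fun t => dotv (e k t) (F (dia k t))) = 0.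
Hypothesis e_w0 : forall k, E P (fun t => dotv (e k t) (F (w0 k t))) = 0.
Hypothesis eps_cst : forall k x, E P (fun t => dotv (eps k t) x) = 0.
Hypothesis eps_w : forall k, E P (fun t => dotv (eps k t) (w k t)) = 0.
Hypothesis eps_S : forall k, E P (fun t => dotv (eps k t) (S k t)) = 0.
Hypothesis eps_e : forall k, E P (fun t => dotv (eps k t) (e k t)) = 0.
Hypothesis eps_dia : forall k, E P (fun t => dotv (eps k t) (F (dia k t))) = 0.
Hypothesis eps_Fw : forall k, E P (fun t => dotv (eps k t) (F (w k t))) = 0.
Hypothesis w0_close : forall k t,
  L * enorm (w k t - w0 k t) <= 3 / 4 * enorm (e k t).

Let LFw k : L2 P (fun t => F (w k t)). Proof. exact: L2_lipschitz lipF _. Qed.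
Let LFw0 k : L2 P (fun t => F (w0 k t)). Proof. exact: L2_lipschitz lipF _. Qed.
Let LFd k : L2 P (fun t => F (dia k t)). Proof. exact: L2_lipschitz lipF _. Qed.
Let LS k : L2 P (S k). Proof. by apply: L2_sum => j; exact: L2Z. Qed.

(** [A] and [D] measure the backward and the forward step of the noisy run, and [V] its distance to
    the noise-free run. [B] and [Fd] are the analogues of [A] and [D] for the difference of the two
    runs. *)
Let A k := E P (fun t => dotv (z k t - w k t) (z k t - w k t)).
Let D k := E P (fun t => dotv (z k.+1 t - w k t) (z k.+1 t - w k t)).
Let V k := E P (fun t => dotv (z k t - z' k) (z k t - z' k)).
Let bv k t := (z k t - z' k) - (w k t - w' k).
Let fv k t := (z k.+1 t - z' k.+1) - (w k t - w' k).
Let B k := E P (fun t => dotv (bv k t) (bv k t)).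
Let Fd k := E P (fun t => dotv (fv k t) (fv k t)).
Let Psi k t := F (dia k t) - F (w k t).
Let Phi k t := Psi k t - (F (dia' k) - F (w' k)).
Let N K := sigma ^+ 2 * \sum_(k < K) alpha k ^+ 2.

Let LPsi k : L2 P (Psi k). Proof. exact: L2B. Qed.
Let LPhi k : L2 P (Phi k). Proof. by apply: L2B => //; exact: L2_cst. Qed.

(* The noise [e k] influences [w k], but only through the proximal step, so
   that it can be removed at the cost of a multiple of its own variance. *)
Lemma e_Psi k : E P (fun t => dotv (e k t) (Psi k t)) <= 3 / 4 * sigma ^+ 2.
Proof.
(* The two added terms have mean zero, and what remains pointwise is <e, F w0 - F w>, at most |e| L
   |w - w0|. *)
have : E P (fun t => dotv (e k t) (Psi k t) - dotv (e k t) (F (dia k t))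
    + dotv (e k t) (F (w0 k t))) <=
  E P (fun t => 3 / 4 * dotv (e k t) (e k t)).
  apply: E_le; [integ|integ|move=> t].
  have := cauchy_schwarz (e k t) (F (w0 k t) - F (w k t)).
  have := w0_close k t; have := lipF (w0 k t) (w k t).
  rewrite (enormB (w0 k t)) /Psi !dotvE -(enorm_sqr (e k t)).
  have := enorm_ge0 (e k t); nra.
rewrite ED ?EB ?EZ; [|integ..].
rewrite e_dia e_w0 => h; have := e_var k; lra.
Qed.

(** The constant 7/2 collects the two variances and twice 3/4 from the cross term of [e] with [psi];
    the cross terms with [eps] vanish. *)
Let noisy (psi : Om -> 'rV[R]_m) k : L2 P psi ->
  E P (fun t => dotv (eps k t) (psi t)) = 0 ->
  E P (fun t => dotv (e k t) (psi t)) <= 3 / 4 * sigma ^+ 2 ->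
  E P (fun t => dotv (psi t + e k t - eps k t) (psi t + e k t - eps k t)) <=
    E P (fun t => dotv (psi t) (psi t)) + 7 / 2 * sigma ^+ 2.
Proof.
move=> Lpsi eps0 e0.
rewrite (_ : (fun t => _) = (fun t => dotv (psi t) (psi t) + 2 * dotv (e k t) (psi t)
  + dotv (e k t) (e k t) + dotv (eps k t) (eps k t)
  - 2 * dotv (eps k t) (psi t) - 2 * dotv (eps k t) (e k t))); last first.
  apply/funext => t; rewrite !dotvE (dotvC (psi t) (eps k t)).
  by rewrite (dotvC (psi t) (e k t)) (dotvC (e k t) (eps k t)); ring.
rewrite !(EB, ED, EZ); [|integ..].
rewrite eps0 eps_e; have := e_var k; have := eps_var k; lra.
Qed.

Let D_le k : D k <= alpha k ^+ 2 *
  (E P (fun t => dotv (Psi k t) (Psi k t)) + 7 / 2 * sigma ^+ 2).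
Proof.
rewrite /D (_ : (fun t => _) = (fun t => alpha k ^+ 2 *
   dotv (Psi k t + e k t - eps k t) (Psi k t + e k t - eps k t))); last first.
  apply/funext => t; rewrite zE addrC addKr /Psi dotvZl dotvZr mulrA -expr2.
  by congr (_ * dotv _ _); apply/rowP => i; rewrite !mxE; ring.
rewrite EZ; last by integ.
rewrite ler_pM2l ?exprn_gt0//; apply: noisy => //; last exact: e_Psi.
rewrite (_ : (fun t => _) = fun t =>
  dotv (eps k t) (F (dia k t)) - dotv (eps k t) (F (w k t))); last first.
  by apply/funext => t; rewrite !dotvE.
by rewrite EB ?eps_dia ?eps_Fw ?subrr//; integ.
Qed.

Let Fd_le k : Fd k <= alpha k ^+ 2 *
  (E P (fun t => dotv (Phi k t) (Phi k t)) + 7 / 2 * sigma ^+ 2).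
Proof.
rewrite /Fd (_ : (fun t => _) = (fun t => alpha k ^+ 2 *
   dotv (Phi k t + e k t - eps k t) (Phi k t + e k t - eps k t))); last first.
  apply/funext => t.
  rewrite (_ : fv k t = alpha k *: (Phi k t + e k t - eps k t)).
    by rewrite dotvZl dotvZr mulrA -expr2.
  by rewrite /fv zE zE' /Phi /Psi; apply/rowP => i; rewrite !mxE; ring.
rewrite EZ; last by integ.
rewrite ler_pM2l ?exprn_gt0//; apply: noisy => //.
- rewrite (_ : (fun t => _) = fun t => dotv (eps k t) (F (dia k t)) -
    dotv (eps k t) (F (w k t)) - dotv (eps k t) (F (dia' k) - F (w' k))); last first.
    by apply/funext => t; rewrite /Phi /Psi !dotvE.
  by rewrite !EB ?eps_dia ?eps_Fw ?eps_cst ?subrr//; integ.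
- rewrite (_ : (fun t => _) = fun t => dotv (e k t) (Psi k t) -
    dotv (e k t) (F (dia' k) - F (w' k))); last first.
    by apply/funext => t; rewrite /Phi !dotvE.
  by rewrite EB ?e_cst ?subr0 ?e_Psi//; integ.
Qed.

(** The one-step inequality for the difference of the two runs. The noise [e] needs no separate
    term, because it enters only through the argument of the prox, which is a monotone map;
    monotonicity of [F] removes F w - F w', and the remaining term in [eps] has mean zero. *)
Let V_rec k : V k.+1 <= V k + Fd k - B k.
Proof.
have h t : dotv (z k.+1 t - z' k.+1) (z k.+1 t - z' k.+1) <=
    dotv (z k t - z' k) (z k t - z' k) + dotv (fv k t) (fv k t)
    - dotv (bv k t) (bv k t)
    - 2 * alpha k * (dotv (eps k t) (w k t) - dotv (eps k t) (w' k)).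
  have vi : 0 <= dotv ((z k t - z' k) - alpha k *: (F (dia k t) + e k t - F (dia' k))
      - (w k t - w' k)) (w k t - w' k).
    have := prox_vi (z k t - alpha k *: (F (dia k t) + e k t)) (al0 k) pr
      (prox_fin_num (z' k - alpha k *: F (dia' k)) (al0 k) pr).
    have := prox_vi (z' k - alpha k *: F (dia' k)) (al0 k) pr
      (prox_fin_num (z k t - alpha k *: (F (dia k t) + e k t)) (al0 k) pr).
    rewrite -wE -wE' !dotvE; lra.
  have mono := mulr_ge0 (ltW (al0 k)) (monoF (w k t) (w' k)).
  have dz : z k.+1 t - z' k.+1 = (w k t - w' k) + alpha k *:
      (F (dia k t) + e k t - F (dia' k)) -
      alpha k *: (F (w k t) - F (w' k)) - alpha k *: eps k t.
    by rewrite zE zE'; apply/rowP => i; rewrite !mxE; ring.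
  have -> : dotv (eps k t) (w k t) - dotv (eps k t) (w' k) =
      dotv (eps k t) (w k t - w' k) by rewrite !dotvE.
  rewrite /fv /bv dz; move: vi mono.
  move: (z k t - z' k) (w k t - w' k) (F (dia k t) + e k t - F (dia' k))
    (F (w k t) - F (w' k)) (eps k t) => x y g u s.
  rewrite !dotvE (dotvC y x) (dotvC y g) (dotvC u g) (dotvC u y)
    (dotvC s y) (dotvC s g) (dotvC s u); lra.
have : V k.+1 <= E P (fun t => dotv (z k t - z' k) (z k t - z' k)
    + dotv (fv k t) (fv k t) - dotv (bv k t) (bv k t)
    - 2 * alpha k * (dotv (eps k t) (w k t) - dotv (eps k t) (w' k))).
  by apply: E_le h; rewrite /fv /bv; integ.
rewrite !(EB, ED, EZ); [|rewrite /fv /bv; integ..].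
by rewrite eps_w eps_cst !subr0 mulr0 subr0.
Qed.

Let V_le K : V K <= \sum_(k < K) (Fd k - B k).
Proof.
elim: K => [|K ih].
  rewrite big_ord0 /V (_ : (fun t => _) = fun=> 0) ?E_cst//.
  by apply/funext => t; rewrite z0E z0E' subrr dot0v.
by rewrite big_ord_recr/=; apply: le_trans (V_rec K) _; rewrite -addrA lerD2r.
Qed.

Let S_recr k : S k.+1 = fun t => S k t + alpha k *: eps k t.
Proof. by apply/funext => t; rewrite /S big_ord_recr. Qed.

Let S_var K : E P (fun t => dotv (S K t) (S K t)) <= N K.
Proof.
rewrite /N; elim: K => [|K ih].
  rewrite big_ord0 mulr0 (_ : (fun t => _) = fun=> 0) ?E_cst//.
  by apply/funext => t; rewrite /S big_ord0 dot0v.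
rewrite big_ord_recr/= mulrDr S_recr (_ : (fun t => _) = (fun t =>
    dotv (S K t) (S K t) + 2 * alpha K * dotv (eps K t) (S K t)
    + alpha K ^+ 2 * dotv (eps K t) (eps K t))); last first.
  by apply/funext => t; rewrite !dotvE (dotvC (S K t) (eps K t)); ring.
rewrite !(ED, EZ); [|integ..].
rewrite eps_S mulr0 addr0 lerD// mulrC ler_pM2r ?exprn_gt0//.
Qed.

Definition noise_bound K t := 2^-1 * dotv (S K t) (S K t) + dotv (z K t) (S K t)
  - \sum_(k < K) alpha k * dotv (eps k t) (w k t)
  + 2^-1 * \sum_(k < K) (dotv (z k.+1 t - w k t) (z k.+1 t - w k t)
                        - dotv (z k t - w k t) (z k t - w k t)).

Lemma L1_noise_bound K : L1 P (noise_bound K).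
Proof. rewrite /noise_bound; integ. Qed.

(* The noise enters through the linear term <S, y>; completing the square with
   the term -|z - y|^2 / 2 left over by the telescoping makes it independent
   of y, so that the supremum over y can be taken before the expectation. *)
Lemma le_noise_bound K t y : r y \is a fin_num ->
  \sum_(k < K) alpha k * (dotv (F (w k t)) (w k t - y)
                          + (fine (r (w k t)) - fine (r y))) <=
  2^-1 * dotv (z0 - y) (z0 - y) + noise_bound K t.
Proof.
move=> ry.
suff h : \sum_(k < K) alpha k * (dotv (F (w k t)) (w k t - y)
                          + (fine (r (w k t)) - fine (r y))) <=
    2^-1 * dotv (z0 - y) (z0 - y) - 2^-1 * dotv (z K t - y) (z K t - y)
    - \sum_(k < K) alpha k * dotv (eps k t) (w k t) + dotv (S K t) y
    + 2^-1 * \sum_(k < K) (dotv (z k.+1 t - w k t) (z k.+1 t - w k t)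
                        - dotv (z k t - w k t) (z k t - w k t)).
  have := dotv_ge0 (z K t + S K t - y); move: h.
  rewrite /noise_bound !dotvE (dotvC (S K t) (z K t)) (dotvC y (S K t))
    (dotvC y (z K t)); lra.
elim: K => [|K ih].
  by rewrite !big_ord0 z0E /S big_ord0 dot0v; lra.
rewrite !big_ord_recr/= -/(S K t); move: ih.
have := prox_vi (z K t - alpha K *: (F (dia K t) + e K t)) (al0 K) pr ry.
rewrite -wE; set rw := fine (r (w K t)).
have -> : S K.+1 t = S K t + alpha K *: eps K t by rewrite S_recr.
(* Expressing the prox step through [z K.+1] eliminates both [dia] and [e], so that one argument
   covers both algorithms. *)
have zeq : alpha K *: (F (dia K t) + e K t) =
    z K.+1 t - w K t + alpha K *: (F (w K t) + eps K t).
  by rewrite zE; apply/rowP => i; rewrite !mxE; ring.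
rewrite zeq; move: (z K t) (z K.+1 t) (w K t) (F (w K t)) (eps K t) (S K t)
  => x x' v u s q.
rewrite !dotvE ?(dotvC y x) ?(dotvC y x') ?(dotvC v x) ?(dotvC v x') ?(dotvC y v)
  ?(dotvC y s) ?(dotvC y q).
lra.
Qed.

(** [delta] is the weight of Young's inequality for <z_K - z'_K, S>. A small weight keeps the sum of
    [A] absorbable, at the price of its inverse in front of the noise. *)
Lemma E_noise_bound K delta : 0 < delta ->
  E P (noise_bound K) <= (1 + delta^-1) / 2 * N K
    + delta / 2 * \sum_(k < K) (Fd k - B k) + 2^-1 * \sum_(k < K) (D k - A k).
Proof.
move=> delta0.
have LzK : L2 P (fun t => z K t - z' K) by integ.
have h1 : E P (fun t => dotv (z K t) (S K t)) <=
    delta / 2 * V K + delta^-1 / 2 * N K.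
  have S0 : E P (fun t => dotv (z' K) (S K t)) = 0.
    rewrite (_ : (fun t => _) = (fun t =>
      \sum_(k < K) alpha k * dotv (eps k t) (z' K))); last first.
      apply/funext => t; rewrite dotvC dotv_suml.
      by apply: eq_bigr => k _; rewrite dotvZl.
    rewrite E_sum => [|k]; last by integ.
    by rewrite big1// => k _; rewrite EZ ?eps_cst ?mulr0//; integ.
  have : E P (fun t => 2 * (dotv (z K t) (S K t) - dotv (z' K) (S K t))) <=
     E P (fun t => delta * dotv (z K t - z' K) (z K t - z' K)
       + delta^-1 * dotv (S K t) (S K t)).
    apply: E_le; [integ|integ|move=> t].
    have := young_dotv (z K t - z' K) (S K t) delta0.
    by rewrite !dotvE; lra.
  rewrite !(EB, ED, EZ); [|integ..].
  rewrite S0 -/(V K); have := S_var K.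
  have : 0 < delta^-1 by rewrite invr_gt0.
  move: delta^-1 => c c0 SN.
  have : c * E P (fun t => dotv (S K t) (S K t)) <= c * N K by rewrite ler_pM2l.
  lra.
have -> : E P (noise_bound K) = 2^-1 * E P (fun t => dotv (S K t) (S K t))
    + E P (fun t => dotv (z K t) (S K t)) + 2^-1 * \sum_(k < K) (D k - A k).
  have e1 : E P (fun t => \sum_(k < K) alpha k * dotv (eps k t) (w k t)) = 0.
    rewrite E_sum => [|k]; last by integ.
    by rewrite big1// => k _; rewrite EZ ?eps_w ?mulr0//; integ.
  have e2 : E P (fun t => \sum_(k < K)
      (dotv (z k.+1 t - w k t) (z k.+1 t - w k t)
       - dotv (z k t - w k t) (z k t - w k t))) = \sum_(k < K) (D k - A k).
    rewrite E_sum => [|k]; last by integ.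
    by apply: eq_bigr => k _; rewrite EB//; integ.
  by rewrite /noise_bound !(EB, ED, EZ) ?e1 ?e2 ?subr0//; integ.
have := S_var K.
have : delta / 2 * V K <= delta / 2 * \sum_(k < K) (Fd k - B k).
  by rewrite ler_pM2l ?divr_gt0// V_le.
lra.
Qed.

(** The step of the noise-free run is traded for that of the noisy run and the difference of both,
    because the negative terms available for absorption are those of [A] and [B]. *)
Let Phi_le k t : enorm (Phi k t) <= L * (2 * enorm (dia k t - w k t)
   + enorm ((dia k t - w k t) - (dia' k - w' k))).
Proof.
have h1 := enormD (Psi k t) (- (F (dia' k) - F (w' k))).
have h2 := lipF (dia k t) (w k t); have h3 := lipF (dia' k) (w' k).
have tri (x y : 'rV[R]_m) : enorm y <= enorm x + enorm (x - y).
  by have := enormD x (y - x); rewrite addrC subrK (enormB y).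
have h4 := tri (dia k t - w k t) (dia' k - w' k).
rewrite enormN in h1.
rewrite -/(Phi k t) in h1; rewrite -/(Psi k t) in h2.
move: h4; rewrite -(ler_pM2l L0) => h4; lra.
Qed.

Let sum_delay (f g : nat -> R) K : (forall k, 0 <= f k) -> g 0 = 0 ->
  (forall k, g k.+1 = f k) -> \sum_(k < K) g k <= \sum_(k < K) f k.
Proof.
move=> f0 g0 gf; case: K => [|K]; first by rewrite !big_ord0.
rewrite big_ord_recl g0 add0r [leRHS]big_ord_recr/=.
rewrite (eq_bigr (fun k : 'I_K => f k)) => [|k _]; last exact: gf.
by rewrite lerDl.
Qed.

Let E_dotv_ge0 (f : Om -> 'rV[R]_m) : 0 <= E P (fun t => dotv (f t) (f t)).
Proof. by apply: E_ge0 => t; exact: dotv_ge0. Qed.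

Let N_ge0 K : 0 <= N K.
Proof. by rewrite mulr_ge0 ?sqr_ge0// sumr_ge0// => k _; rewrite sqr_ge0. Qed.

Lemma E_noise_bound_FBF K : (forall k, dia k = z k) ->
  (forall k, dia' k = z' k) -> (forall k, (alpha k * L) ^+ 2 <= 2^-1) ->
  E P (noise_bound K) <= 9 * N K.
Proof.
move=> dz dz' aL.
have Dk k : D k <= 2^-1 * A k + 7 / 2 * (sigma ^+ 2 * alpha k ^+ 2).
  apply: le_trans (D_le k) _; rewrite mulrDr lerD//; last first.
    by lra.
  rewrite -!EZ; [|integ..].
  apply: E_le; [integ|integ|move=> t]; rewrite -!enorm_sqr.
  have := lipF (dia k t) (w k t); rewrite -/(Psi k t) dz => h.
  have : (alpha k * enorm (Psi k t)) ^+ 2 <=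
      (alpha k * L) ^+ 2 * enorm (z k t - w k t) ^+ 2.
    rewrite -exprMn lerXn2r ?nnegrE ?mulr_ge0 ?enorm_ge0
      ?(ltW L0) ?(ltW (al0 k))//.
    by rewrite -mulrA ler_pM2l.
  rewrite exprMn => /le_trans; apply; apply: ler_wpM2r => //.
  exact: sqr_ge0.
have Fk k : Fd k - B k <= 4 * A k + 7 / 2 * (sigma ^+ 2 * alpha k ^+ 2).
  rewrite lerBlDr; apply: le_trans (Fd_le k) _.
  rewrite addrAC mulrDr; apply: lerD; last by lra.
  rewrite -!EZ -?ED; [|rewrite /bv; integ..].
  apply: E_le; [integ|rewrite /bv; integ|move=> t]; rewrite -!enorm_sqr.
  have := Phi_le k t; rewrite dz dz'.
  have -> : z k t - w k t - (z' k - w' k) = bv k t.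
    by apply/rowP => i; rewrite !mxE; ring.
  set p := enorm (z k t - w k t); set q := enorm (bv k t) => h.
  have p0 : 0 <= p := enorm_ge0 _; have q0 : 0 <= q := enorm_ge0 _.
  have : (alpha k * enorm (Phi k t)) ^+ 2 <=
      (alpha k * L) ^+ 2 * (2 * p + q) ^+ 2.
    rewrite -exprMn lerXn2r ?nnegrE ?mulr_ge0 ?addr_ge0 ?mulr_ge0 ?enorm_ge0
      ?(ltW L0) ?(ltW (al0 k))//.
    by rewrite -mulrA ler_pM2l.
  rewrite exprMn => /le_trans; apply.
  apply: (@le_trans _ _ (2^-1 * (2 * p + q) ^+ 2)).
    by apply: ler_wpM2r => //; exact: sqr_ge0.
  (* Half of (2p + q)^2 is at most 4p^2 + q^2, where q^2 is exactly what -[B] absorbs. *)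
  have := sqr_ge0 (2 * p - q); lra.
(* The coefficient of the sum of [A] is 4 delta / 2 - 1/4, which vanishes for this weight; the noise
   then costs 9/2 + 7/32 + 7/4 < 9. *)
have delta0 : 0 < 8^-1 :> R by [].
have := E_noise_bound K delta0.
have h1 : \sum_(k < K) (D k - A k) <=
    - (2^-1) * (\sum_(k < K) A k) + 7 / 2 * N K.
  rewrite /N !mulr_sumr -big_split/=; apply: ler_sum => k _.
  by have := Dk k; lra.
have h2 : \sum_(k < K) (Fd k - B k) <= 4 * (\sum_(k < K) A k) + 7 / 2 * N K.
  by rewrite /N !mulr_sumr -big_split/=; apply: ler_sum => k _; exact: Fk.
have := N_ge0 K; rewrite invrK; lra.
Qed.

Lemma E_noise_bound_FBFp K : dia 0 = z 0 -> (forall k, dia k.+1 = w k) ->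
  dia' 0 = z' 0 -> (forall k, dia' k.+1 = w' k) ->
  (forall k, alpha k * L <= 3^-1) ->
  E P (noise_bound K) <= 9 * N K.
Proof.
move=> d0 dS d0' dS' aL.
(* The prox step evaluates [F] at the old point w_{k-1} instead of z_k; their difference is the
   preceding forward step, absent at k = 0. Its shifted sums are absorbed by the unshifted ones. *)
pose dp k t := if k is j.+1 then z k t - w j t else 0.
pose fp k t := if k is j.+1 then fv j t else 0.
pose Dp k := E P (fun t => dotv (dp k t) (dp k t)).
pose Fp k := E P (fun t => dotv (fp k t) (fp k t)).
have Lfv k : L2 P (fv k) by rewrite /fv; integ.
have Lbv k : L2 P (bv k) by rewrite /bv; integ.
have Ldp k : L2 P (dp k) by case: k => [|k]; rewrite /dp; integ.
have Lfp k : L2 P (fp k) by case: k => [|k]; rewrite /fp; integ.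
have diaw k t : dia k t - w k t = (z k t - w k t) - dp k t.
  case: k => [|k]; first by rewrite d0 /dp subr0.
  by rewrite dS /dp; apply/rowP => i; rewrite !mxE; ring.
have ddia k t : dia k t - w k t - (dia' k - w' k) = bv k t - fp k t.
  case: k => [|k]; rewrite /bv /fp /fv ?d0 ?d0' ?dS ?dS' ?subr0;
    by apply/rowP => i; rewrite !mxE; ring.
have diaw2 k t : enorm (dia k t - w k t) ^+ 2 <=
    3 / 2 * dotv (z k t - w k t) (z k t - w k t) + 3 * dotv (dp k t) (dp k t).
  rewrite enorm_sqr diaw.
  have := dotv_ge0 (z k t - w k t + 2 *: dp k t).
  move: (z k t - w k t) (dp k t) => x y; rewrite !dotvE ?(dotvC y x); lra.
have aL2 k : (alpha k * L) ^+ 2 <= 9^-1.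
  have -> : 9^-1 = 3^-1 ^+ 2 :> R by rewrite exprVn -natrX.
  by rewrite lerXn2r ?nnegrE ?mulr_ge0 ?(ltW L0) ?(ltW (al0 k)) ?invr_ge0.
have Dk k : D k <= 6^-1 * A k + 3^-1 * Dp k
    + 7 / 2 * (sigma ^+ 2 * alpha k ^+ 2).
  apply: le_trans (D_le k) _; rewrite mulrDr lerD//; last first.
    by lra.
  rewrite -!EZ -?ED; [|integ..].
  apply: E_le; [integ|integ|move=> t]; rewrite -(enorm_sqr (Psi k t)).
  have := lipF (dia k t) (w k t); rewrite -/(Psi k t) => h.
  have : (alpha k * enorm (Psi k t)) ^+ 2 <=
      (alpha k * L) ^+ 2 * enorm (dia k t - w k t) ^+ 2.
    rewrite -exprMn lerXn2r ?nnegrE ?mulr_ge0 ?enorm_ge0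
      ?(ltW L0) ?(ltW (al0 k))//.
    by rewrite -mulrA ler_pM2l.
  rewrite exprMn => /le_trans; apply.
  apply: (@le_trans _ _ (9^-1 * enorm (dia k t - w k t) ^+ 2)).
    by apply: ler_wpM2r => //; exact: sqr_ge0.
  have := diaw2 k t; lra.
have Fk k : Fd k <= 4 / 3 * A k + 8 / 3 * Dp k + 2 / 3 * B k + 3^-1 * Fp k
    + 7 / 2 * (sigma ^+ 2 * alpha k ^+ 2).
  apply: le_trans (Fd_le k) _.
  rewrite mulrDr lerD//; last by lra.
  rewrite -!EZ -?ED; [|integ..].
  apply: E_le; [integ|integ|move=> t]; rewrite -(enorm_sqr (Phi k t)).
  have := Phi_le k t; rewrite ddia.
  have := enormD (bv k t) (- fp k t); rewrite enormN.
  have := diaw2 k t.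
  rewrite -(enorm_sqr (bv k t)) -(enorm_sqr (fp k t)).
  set p := enorm (dia k t - w k t); set q := enorm (bv k t).
  set f := enorm (fp k t) => hp hq h.
  have p0 : 0 <= p := enorm_ge0 _; have q0 : 0 <= q := enorm_ge0 _.
  have f0 : 0 <= f := enorm_ge0 _.
  have {}h : enorm (Phi k t) <= L * (2 * p + (q + f)).
    by apply: le_trans h _; rewrite ler_pM2l// lerD2l.
  have : (alpha k * enorm (Phi k t)) ^+ 2 <=
      (alpha k * L) ^+ 2 * (2 * p + (q + f)) ^+ 2.
    rewrite -exprMn lerXn2r ?nnegrE ?mulr_ge0 ?addr_ge0 ?mulr_ge0 ?enorm_ge0
      ?(ltW L0) ?(ltW (al0 k))//.
    by rewrite -mulrA ler_pM2l.
  rewrite exprMn => /le_trans; apply.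
  apply: (@le_trans _ _ (9^-1 * (2 * p + (q + f)) ^+ 2)).
    by apply: ler_wpM2r => //; exact: sqr_ge0.
  (* Cauchy-Schwarz with the weights 1/2, 1/6 and 1/3 *)
  have := sqr_ge0 (4 * p - 6 * q); have := sqr_ge0 (4 * p - 3 * f).
  have := sqr_ge0 (6 * q - 3 * f); lra.
(* Solving for the sums gives D <= A/4 + 21/4 N and Fd - B <= 3 A + 105/4 N. The coefficient of A is
   3 delta / 2 - 3/8, which vanishes for this weight; the noise costs 5/2 + 105/32 + 21/8 = 269/32 <
   9. *)
have delta0 : 0 < 4^-1 :> R by [].
have := E_noise_bound K delta0.
have D0 k : 0 <= D k by exact: E_dotv_ge0.
have F0 k : 0 <= Fd k by exact: E_dotv_ge0.
have Dp0 : Dp 0 = 0.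
  rewrite /Dp (_ : (fun t => _) = fun=> 0) ?E_cst//.
  by apply/funext => t; rewrite dot0v.
have Fp0 : Fp 0 = 0.
  rewrite /Fp (_ : (fun t => _) = fun=> 0) ?E_cst//.
  by apply/funext => t; rewrite dot0v.
have sD : \sum_(k < K) Dp k <= \sum_(k < K) D k by apply: sum_delay.
have sF : \sum_(k < K) Fp k <= \sum_(k < K) Fd k by apply: sum_delay.
have h1 : \sum_(k < K) D k <= 6^-1 * (\sum_(k < K) A k)
    + 3^-1 * (\sum_(k < K) Dp k) + 7 / 2 * N K.
  by rewrite /N !mulr_sumr -!big_split/=; apply: ler_sum => k _; exact: Dk.
have h2 : \sum_(k < K) Fd k <= 4 / 3 * (\sum_(k < K) A k)
    + 8 / 3 * (\sum_(k < K) Dp k) + 2 / 3 * (\sum_(k < K) B k)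
    + 3^-1 * (\sum_(k < K) Fp k) + 7 / 2 * N K.
  by rewrite /N !mulr_sumr -!big_split/=; apply: ler_sum => k _; exact: Fk.
have arith (x b y f y' f' n : R) : 0 <= n -> y' <= y -> f' <= f ->
    y <= 6^-1 * x + 3^-1 * y' + 7 / 2 * n ->
    f <= 4 / 3 * x + 8 / 3 * y' + 2 / 3 * b + 3^-1 * f' + 7 / 2 * n ->
    (1 + 4) / 2 * n + 4^-1 / 2 * (f - b) + 2^-1 * (y - x) <= 9 * n by lra.
rewrite !sumrB invrK => /le_trans; apply.
exact: arith (N_ge0 K) sD sF h1 h2.
Qed.

End core.

(** * From the iterates to the gap function *)

(** The gap is a supremum over a possibly uncountable set, and its measurability in the outcome is
    left open. The integrals of positive and negative parts are suprema over simple functions below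
    them, hence monotone for arbitrary functions. *)
Lemma le_integralT d (T : measurableType d) (R : realType)
    (mu : {measure set T -> \bar R}) (f g : T -> \bar R) :
  (forall t, f t <= g t)%E -> (\int[mu]_t f t <= \int[mu]_t g t)%E.
Proof.
move=> fg; rewrite integralE [leRHS]integralE.
apply: leeB; rewrite !ge0_integralTE//; apply: ge_ereal_sup => _ [h hf <-];
  apply: ereal_sup_ubound; exists h => // t; apply: le_trans (hf t) _.
- by rewrite !funeposE ge_max !le_max fg lexx orbT.
- by rewrite !funenegE ge_max !le_max leeN2 fg lexx orbT.
Qed.

Section averages.
Context {R : realType} {m : nat}.
Variables (alpha : nat -> R) (al0 : forall k, 0 < alpha k).

Lemma sum_weights_gt0 K : (0 < K)%N -> 0 < \sum_(k < K) alpha k.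
Proof.
case: K => // K _; rewrite big_ord_recr/= ltr_wpDl//.
by apply: sumr_ge0 => k _; exact: ltW.
Qed.

Lemma econvex_average (f : 'rV[R]_m -> \bar R) (x : nat -> 'rV[R]_m) K :
  econvex f -> (forall k, f (x k) \is a fin_num) -> (0 < K)%N ->
  (f ((\sum_(k < K) alpha k)^-1 *: \sum_(k < K) alpha k *: x k) <=
   ((\sum_(k < K) alpha k)^-1 * \sum_(k < K) alpha k * fine (f (x k)))%:E)%E.
Proof.
move=> cf fx; case: K => // K _; elim: K => [|K ih].
  rewrite !big_ord1 scalerA mulrA mulVf ?gt_eqF// scale1r mul1r fineK//.
rewrite big_ord_recr/= [in X in (f (_ *: X) <= _)%E]big_ord_recr/=.
rewrite [in X in (_ <= (_ * X)%:E)%E]big_ord_recr/=.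
have T0 := @sum_weights_gt0 K.+1 isT.
move: (\sum_(k < K.+1) alpha k) T0 ih => T T0.
move: (\sum_(k < K.+1) alpha k *: x k) => u.
move: (\sum_(k < K.+1) alpha k * fine (f (x k))) => s ih.
set al := alpha K.+1; have aK : 0 < al := al0 _.
have Tal : 0 < T + al by rewrite addr_gt0.
(* The new average is a convex combination of the old one and the new point. *)
have -> : (T + al)^-1 *: (u + al *: x K.+1) =
    (T / (T + al)) *: (T^-1 *: u) + (1 - T / (T + al)) *: x K.+1.
  have -> : 1 - T / (T + al) = (T + al)^-1 * al by field; rewrite gt_eqF.
  by rewrite scalerDr !scalerA; congr (_ *: _ + _); field; rewrite !gt_eqF.
have c0 : 0 <= T / (T + al) by rewrite divr_ge0 ?ltW.
have c1 : T / (T + al) <= 1 by rewrite ler_pdivrMr// mul1r lerDl ltW.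
apply: le_trans (cf _ _ _ c0 c1) _.
rewrite -(fineK (fx K.+1)).
apply: (@le_trans _ _ ((T / (T + al))%:E * (T^-1 * s)%:E
    + (1 - T / (T + al))%:E * (fine (f (x K.+1)))%:E)%E).
  by apply: leeD => //; apply: lee_wpmul2l => //; rewrite lee_fin.
rewrite -!EFinM -EFinD lee_fin le_eqVlt; apply/orP; left; apply/eqP.
by field; rewrite !gt_eqF.
Qed.

End averages.

(** * Gradient inequalities for convex-concave functions *)

Section convex_gradient.
Context {R : realType}.

Lemma derive_le_increment (V : normedModType R) (g : V -> R) (w h : V) :
  derivable g w h ->
  (forall t, 0 < t -> t <= 1 -> g (t *: h + w) - g w <= t * (g (h + w) - g w)) ->
  'D_h g w <= g (h + w) - g w.
Proof.
move=> dg cg; rewrite leNgt; apply/negP => gD.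
have FF : Filter (0^' : set_system R) by exact: dnbhs_filter.
have := cvgr_gt _ dg _ gD; rewrite near_withinE /=.
move=> /(_ FF)/nbhs_ballP[e /= e0 eq].
pose t := Num.min (e / 2) 1.
have t0 : 0 < t by rewrite lt_min divr_gt0/=.
have te : ball (0 : R) e t.
  rewrite /ball/= sub0r normrN gtr0_norm//.
  by rewrite gt_min ltr_pdivrMr// mulr_natr mulr2n ltrDl e0.
have := eq t te; rewrite gt_eqF// => /(_ isT).
rewrite ltNge => /negP; apply.
rewrite -(ler_pM2l t0) /GRing.scale/= mulrA divff ?gt_eqF// mul1r.
by apply: cg => //; rewrite ge_min lexx orbT.
Qed.

Lemma derive_grad m (Phi : 'rV[R]_m -> R) (w h : 'rV[R]_m) :
  differentiable Phi w -> 'D_h Phi w = dotv (grad Phi w) h.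
Proof.
move=> dPhi; rewrite deriveE// [in LHS](row_sum_delta h) linear_sum.
by apply: eq_bigr => i _; rewrite linearZ/= !mxE deriveE// mulrC.
Qed.

Lemma dotv_row_mx d n (a a' : 'rV[R]_d) (b b' : 'rV[R]_n) :
  dotv (row_mx a b) (row_mx a' b') = dotv a a' + dotv b b'.
Proof.
rewrite /dotv big_split_ord/=; congr (_ + _); apply: eq_bigr => i _.
- by rewrite !row_mxEl.
- by rewrite !row_mxEr.
Qed.

Lemma convex_functionP m (g : 'rV[R]_m -> R) :
  convex_function setT (g : convex_lmodType 'rV[R]_m -> R^o) ->
  forall x y t, 0 <= t -> t <= 1 ->
  g (t *: x + (1 - t) *: y) <= t * g x + (1 - t) * g y.
Proof.
move=> cg x y t t0 t1.
exact: (cg (Itv01 t0 t1) x y (in_setT _) (in_setT _)).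
Qed.

(** The gradient inequalities in the first argument at fixed [v] and in the second at fixed [u] are
    combined so that Phi (u, v) cancels. *)
Lemma convex_concave_gradient d n (Phi : 'rV[R]_(d + n) -> R)
    (u x : 'rV[R]_d) (v y : 'rV[R]_n) :
  convex_concave Phi -> (forall w, differentiable Phi w) ->
  Phi (row_mx u y) - Phi (row_mx x v) <=
  dotv (minimax_op Phi (row_mx u v)) (row_mx u v - row_mx x y).
Proof.
move=> [cx cy] dPhi; set w := row_mx u v.
have hx : dotv (grad Phi w) (row_mx (x - u) 0) <= Phi (row_mx x v) - Phi w.
  have xw : row_mx (x - u) 0 + w = row_mx x v.
    by rewrite /w add_row_mx subrK add0r.
  rewrite -derive_grad// -xw; apply: derive_le_increment.
    exact: diff_derivable.
  move=> t t0 t1; rewrite xw scale_row_mx scaler0 /w add_row_mx add0r.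
  have -> : t *: (x - u) + u = t *: x + (1 - t) *: u.
    by apply/rowP => i; rewrite !mxE; ring.
  have := convex_functionP (cx v) x u (ltW t0) t1; lra.
have hy : dotv (grad Phi w) (row_mx 0 (y - v)) >= Phi (row_mx u y) - Phi w.
  have yw : row_mx 0 (y - v) + w = row_mx u y.
    by rewrite /w add_row_mx subrK add0r.
  have NE u' : (- Phi) u' = - Phi u' by [].
  have dN : differentiable (- Phi) w by exact: differentiableN.
  have : 'D_(row_mx 0 (y - v)) (- Phi) w <=
      (- Phi) (row_mx 0 (y - v) + w) - (- Phi) w.
    apply: derive_le_increment; first exact: diff_derivable.
    move=> t t0 t1; rewrite yw scale_row_mx scaler0 /w add_row_mx add0r.
    have -> : t *: (y - v) + v = t *: y + (1 - t) *: v.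
      by apply/rowP => i; rewrite !mxE; ring.
    have := convex_functionP (cy u) y v (ltW t0) t1.
    rewrite !NE; lra.
  rewrite deriveN; last exact: diff_derivable.
  rewrite derive_grad// yw !NE; lra.
move: hx hy; rewrite /minimax_op -[grad Phi w]hsubmxK row_mxKl row_mxKr.
rewrite /w opp_row_mx add_row_mx !dotv_row_mx !dotvE !dotv0; lra.
Qed.

End convex_gradient.

Section gap_average.
Context {R : realType}.
Variables (alpha : nat -> R) (al0 : forall k, 0 < alpha k).

Let econvex_EFin m (g : 'rV[R]_m -> R) :
  convex_function setT (g : convex_lmodType 'rV[R]_m -> R^o) ->
  econvex (EFin \o g).
Proof.
move=> cg x y t t0 t1; rewrite /= -!EFinM -EFinD lee_fin.
exact: convex_functionP.
Qed.

Let average_fin_num m (r : 'rV[R]_m -> \bar R) (x : nat -> 'rV[R]_m) K :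
  proper_convex_lsc r -> (forall k, r (x k) \is a fin_num) -> (0 < K)%N ->
  r ((\sum_(k < K) alpha k)^-1 *: \sum_(k < K) alpha k *: x k) \is a fin_num.
Proof.
move=> [[rNy _] cr _] rx K0; rewrite fin_numE rNy/= -ltey.
exact: le_lt_trans (econvex_average al0 cr rx K0) (ltry _).
Qed.

Let fine_average m (r : 'rV[R]_m -> \bar R) (x : nat -> 'rV[R]_m) K :
  proper_convex_lsc r -> (forall k, r (x k) \is a fin_num) -> (0 < K)%N ->
  fine (r ((\sum_(k < K) alpha k)^-1 *: \sum_(k < K) alpha k *: x k)) <=
  (\sum_(k < K) alpha k)^-1 * \sum_(k < K) alpha k * fine (r (x k)).
Proof.
move=> pr rx K0; rewrite -lee_fin fineK; last exact: (average_fin_num pr rx K0).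
by have [_ cr _] := pr; exact: (econvex_average al0 cr rx K0).
Qed.

(** In the general case monotonicity replaces F (x_k) by F y, which makes the inner product affine
    in x_k, so that only [r] needs Jensen's inequality. In the minimax case Jensen is applied to
    [f], [h], Phi in the first and -Phi in the second argument, and the gradient inequality yields
    the inner products. *)
Lemma gap_average_le m (p : problem R m) (L : R) (B : set 'rV[R]_m)
    (x : nat -> 'rV[R]_m) K (c : R) : (0 < K)%N ->
  monotone_op (operator p) -> proper_convex_lsc (regularizer p) ->
  minimax_assumptions L p ->
  (forall k, regularizer p (x k) \is a fin_num) ->
  (forall y, B y -> regularizer p y \is a fin_num ->
    \sum_(k < K) alpha k * (dotv (operator p (x k)) (x k - y)
      + (fine (regularizer p (x k)) - fine (regularizer p y))) <= c) ->
  (gap p B ((\sum_(k < K) alpha k)^-1 *: \sum_(k < K) alpha k *: x k) <=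
    ((\sum_(k < K) alpha k)^-1 * c)%:E)%E.
Proof.
move=> K0; have T0 := sum_weights_gt0 al0 K0.
set T := \sum_(k < K) alpha k in T0 *.
case: p B x => [{}m F r|d n Phi f h] B x /=.
- move=> monoF pr _ rx hc; apply: ge_ereal_sup => _ [y By <-].
  have [[rNy _] _ _] := pr.
  have [ry|ry] := boolP (r y \is a fin_num); last first.
    have -> : r y = +oo%E by move: ry (rNy y); case: (r y).
    by rewrite addeNy leNye.
  have rw := average_fin_num pr rx K0; have rle := fine_average pr rx K0.
  rewrite -/T in rw rle; set w := _ *: _ in rw rle *.
  rewrite -(fineK rw) -(fineK ry) -?EFinN -!EFinD lee_fin.
  have {hc} := hc y By ry.
  have -> : dotv (F y) (w - y) =
      T^-1 * \sum_(k < K) alpha k * dotv (F y) (x k - y).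
    rewrite dotvDr dotvNr /w dotvZr dotvC dotv_suml.
    rewrite -[dotv (F y) y in LHS](mulKf (lt0r_neq0 T0)) -mulrBr; congr (_ * _).
    rewrite mulr_suml -sumrB; apply: eq_bigr => k _.
    by rewrite dotvDr dotvNr dotvZl dotvC mulrBr.
  rewrite -(ler_pM2l T0) in rle; rewrite mulrA divff ?gt_eqF// mul1r in rle.
  move=> hc; rewrite -(ler_pM2l T0) !mulrBr mulrDr !mulrA divff ?gt_eqF// !mul1r.
  apply: le_trans hc.
  apply: (@le_trans _ _ (\sum_(k < K) alpha k * dotv (F y) (x k - y) +
      \sum_(k < K) alpha k * fine (r (x k)) - T * fine (r y))).
    by rewrite lerD2r lerD2l.
  rewrite mulr_suml -big_split/= -sumrB; apply: ler_sum => k _.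
  rewrite -mulrDr -mulrBr ler_pM2l// addrA lerD2r lerD2r.
  have := monoF (x k) y; rewrite dotvDl dotvNl; lra.
- move=> _ _ [cc dPhi _ pf ph] rx hc; apply: ge_ereal_sup => _ [y By <-].
  have [[fNy _] cf _] := pf; have [[hNy _] ch _] := ph.
  have fx k : f (lsubmx (x k)) \is a fin_num.
    by have := rx k; rewrite /minimax_reg fin_numD => /andP[].
  have hx k : h (rsubmx (x k)) \is a fin_num.
    by have := rx k; rewrite /minimax_reg fin_numD => /andP[].
  rewrite !(linearZ, linear_sum)/=.
  rewrite (eq_bigr (fun k : 'I_K => alpha k *: lsubmx (x k))); last first.
    by move=> k _; rewrite linearZ.
  rewrite [in X in (_ - X)%E](eq_bigr
    (fun k : 'I_K => alpha k *: rsubmx (x k))); last first.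
    by move=> k _; rewrite linearZ.
  have fw := average_fin_num pf fx K0; have fle := fine_average pf fx K0.
  have hw := average_fin_num ph hx K0; have hle := fine_average ph hx K0.
  have cx := econvex_average al0 (econvex_EFin (cc.1 (rsubmx y)))
    (fun k => (isT : (Phi (row_mx (lsubmx (x k)) (rsubmx y)))%:E \is a fin_num)) K0.
  have cy := econvex_average al0 (econvex_EFin (cc.2 (lsubmx y)))
    (fun k => (isT : (- Phi (row_mx (lsubmx y) (rsubmx (x k))))%:E \is a fin_num)) K0.
  move: fw fle hw hle cx cy; rewrite /= !lee_fin -/T.
  set u := T^-1 *: \sum_(k < K) _; set v := T^-1 *: \sum_(k < K) _.
  move=> fw fle hw hle cx cy; rewrite /saddle_fun.
  have [hy|hy] := boolP (h (rsubmx y) \is a fin_num); last first.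
    have -> : h (rsubmx y) = +oo%E by move: hy (hNy (rsubmx y)); case: (h _).
    by rewrite addeNy addNye leNye.
  have [fy|fy] := boolP (f (lsubmx y) \is a fin_num); last first.
    have -> : f (lsubmx y) = +oo%E by move: fy (fNy (lsubmx y)); case: (f _).
    by rewrite -(fineK hw) /= addeNy leNye.
  have ry : minimax_reg f h y \is a fin_num by rewrite /minimax_reg fin_numD fy.
  have {hc} := hc y By ry.
  rewrite -(fineK hw) -(fineK fw) -(fineK hy) -(fineK fy).
  rewrite -?EFinN -?EFinD -?EFinN -?EFinD lee_fin => hc.
  rewrite !ler_pdivlMl// in fle hle cx cy *.
  apply: le_trans hc.
  apply: (@le_trans _ _ (\sum_(k < K) alpha k * fine (f (lsubmx (x k)))
     + \sum_(k < K) alpha k * fine (h (rsubmx (x k)))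
     + \sum_(k < K) alpha k * Phi (row_mx (lsubmx (x k)) (rsubmx y))
     + \sum_(k < K) alpha k * - Phi (row_mx (lsubmx y) (rsubmx (x k)))
     - T * (fine (f (lsubmx y)) + fine (h (rsubmx y))))).
    by move: fle hle cx cy; lra.
  rewrite mulr_suml -!big_split/= -sumrB; apply: ler_sum => k _.
  rewrite -!mulrDr -mulrBr ler_pM2l//.
  have := convex_concave_gradient (lsubmx (x k)) (lsubmx y) (rsubmx (x k))
    (rsubmx y) cc dPhi.
  rewrite !hsubmxK /minimax_reg !fineD//; lra.
Qed.

End gap_average.

(** A real [sup] is an upper bound only of a bounded set. Compactness gives a point [u] of [B]
    farthest from [x], and twice its distance bounds all distances in [B]. *)
Lemma diameter_ge (R : realType) m (B : set 'rV[R]_m) x y : compact B ->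
  B x -> B y -> enorm (x - y) <= diameter B.
Proof.
move=> cB Bx By; apply: ub_le_sup; last by exists (y, x).
have lsc : lower_semicontinuous
    (fun v : 'rV[R]_m => 0 + (- 1 * enorm (v - x) ^+ 2)%R%:E)%E.
  apply: (@lower_semicontinuousD _ _ (fun=> 0%E)) => //.
    by move=> u a a0; exists setT => //; exact: filterT.
  exact: continuous_dist_sqr.
have [u Bu umax] := compact_lsc_min lsc (fun=> isT) cB (ex_intro _ x Bx).
have Bdist v : B v -> enorm (v - x) <= enorm (u - x).
  move=> /umax; rewrite !add0e lee_fin !mulN1r lerN2.
  by rewrite ler_pXn2r// nnegrE enorm_ge0.
exists (enorm (u - x) + enorm (u - x)) => _ [[v v'] [/= Bv Bv'] <-].
have -> : v' - v = (v' - x) + (x - v) by rewrite addrA subrK.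
by apply: le_trans (enormD _ _) _; rewrite (enormB x) lerD ?Bdist.
Qed.

(** * The two algorithms as adapted processes *)

Section sampled_process.
Context d d' (Om : measurableType d) (Xi : measurableType d') (R : realType)
  (P : probability Om R) (Q : probability Xi R) (m : nat) (L sigma : R)
  (F : 'rV[R]_m -> 'rV[R]_m) (Fs : 'rV[R]_m -> Xi -> 'rV[R]_m)
  (r : 'rV[R]_m -> \bar R) (alpha : nat -> R) (z0 : 'rV[R]_m)
  (I : choiceType) (X : I -> {mfun Om >-> Xi}).
Hypotheses (L0 : 0 < L) (monoF : monotone_op F) (lipF : lipschitz_op L F)
  (pr : proper_convex_lsc r) (al0 : forall k, 0 < alpha k)
  (Fs_est : stochastic_estimator Q sigma F Fs) (drawn : drawn_from P Q X).

(* [s k] lists the samples drawn before the one used in the prox step [k], and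
   [s' k] those drawn before the sample [xi_ k]. *)
Variables (z w dia zc : nat -> Om -> 'rV[R]_m) (xi_ tri_ : nat -> I)
  (s s' : nat -> seq I).
Hypotheses (us : forall k, uniq (s k)) (us' : forall k, uniq (s' k))
  (tri_s : forall k, tri_ k \notin s k) (xi_s' : forall k, xi_ k \notin s' k)
  (ss' : forall k, {subset s k <= s' k}) (tri_s' : forall k, tri_ k \in s' k)
  (s's' : forall k, {subset s' k <= s' k.+1}) (xi_s'S : forall k, xi_ k \in s' k.+1).
Hypothesis z0E : forall t, z 0 t = z0.
Hypothesis wE : forall k t, w k t =
  prox (alpha k) r (z k t - alpha k *: Fs (dia k t) (X (tri_ k) t)).
Hypothesis zE : forall k t, z k.+1 t = w k t +
  alpha k *: (Fs (dia k t) (X (tri_ k) t) - Fs (w k t) (X (xi_ k) t)).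

Definition past_measurable_rV (u : seq I) (f : Om -> 'rV[R]_m) :=
  measurable_fun setT (f : pastT X u -> borel_rV R m).
Local Notation pm := past_measurable_rV.

Let e k t := noise F Fs (dia k t) (X (tri_ k) t).
Let eps k t := noise F Fs (w k t) (X (xi_ k) t).
(** [zc k] stands for [z k] without the noise of the sample [tri_ k], which in FBFp has already
    entered [z k]. Thus [w0 k] is determined by [s k], and [e k] is orthogonal to functions of
    it. *)
Let w0 k t := prox (alpha k) r (zc k t - alpha k *: F (dia k t)).
Let S k t := \sum_(j < k) alpha j *: eps j t.

Let XQ i A : measurable A -> distribution P (X i) A = Q A.
Proof. by move=> mA; apply: drawn.1. Qed.

Let pmW u v f : {subset u <= v} -> pm u f -> pm v f.
Proof. exact: past_funW. Qed.

Let pm_ambient u f : pm u f -> measurable_fun setT (f : Om -> borel_rV R m).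
Proof. exact: past_fun_measurable. Qed.

Let prox_lip k : lipschitz_op 1 (prox (alpha k) r).
Proof. by move=> x y; rewrite mul1r; exact: prox_nonexpansive. Qed.

Definition adapted_L2 u f := pm u f /\ L2 P f.

Let adapted_B u f g : adapted_L2 u f -> adapted_L2 u g ->
  adapted_L2 u (fun t => f t - g t).
Proof.
by move=> [mf Lf] [mg Lg]; split; [exact: measurable_rVB|exact: L2B].
Qed.

Let adapted_D u f g : adapted_L2 u f -> adapted_L2 u g ->
  adapted_L2 u (fun t => f t + g t).
Proof.
by move=> [mf Lf] [mg Lg]; split; [exact: measurable_rVD|exact: L2D].
Qed.

Let adapted_Z u c f : adapted_L2 u f -> adapted_L2 u (fun t => c *: f t).
Proof. by move=> [mf Lf]; split; [exact: measurable_rVZ|exact: L2Z]. Qed.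

Let adapted_cst u x : adapted_L2 u (fun=> x).
Proof. by split; [exact: measurable_cst|exact: L2_cst]. Qed.

Let adapted_lip u c phi f : lipschitz_op c phi -> adapted_L2 u f ->
  adapted_L2 u (fun t => phi (f t)).
Proof.
move=> lphi [mf Lf]; split; last exact: L2_lipschitz lphi Lf.
exact: measurable_lipschitz lphi mf.
Qed.

Let adaptedW u v f : {subset u <= v} -> adapted_L2 u f -> adapted_L2 v f.
Proof. by move=> uv [mf Lf]; split => //; exact: pmW mf. Qed.

Let adapted_noise u v i f : uniq u -> i \notin u -> {subset u <= v} ->
  i \in v -> adapted_L2 u f ->
  adapted_L2 v (fun t => noise F Fs (f t) (X i t)).
Proof.
move=> uu iu uv iv [mf Lf]; split.
  apply: (measurable_noise Fs_est lipF); first exact: pmW mf.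
  exact: past_sample.
exact: (noise_L2 Fs_est lipF (past_independent drawn uu iu) (@XQ i) mf).
Qed.

Let noise_var u i f : uniq u -> i \notin u -> adapted_L2 u f ->
  E P (fun t => dotv (noise F Fs (f t) (X i t)) (noise F Fs (f t) (X i t)))
    <= sigma ^+ 2.
Proof.
move=> uu iu [mf Lf].
exact: (E_noise_sqr Fs_est lipF (past_independent drawn uu iu) (@XQ i) mf).
Qed.

Let noise_orth u i f g : uniq u -> i \notin u -> adapted_L2 u f ->
  adapted_L2 u g -> E P (fun t => dotv (noise F Fs (f t) (X i t)) (g t)) = 0.
Proof.
move=> uu iu [mf Lf] [mg Lg].
exact: (E_noise_orth Fs_est lipF (past_independent drawn uu iu) (@XQ i) mf mg Lg).
Qed.

(** [v] is left open because FBF, where [dia] is [z], needs [z k.+1] adapted to [s k.+1], whereas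
    FBFp provides only [s' k.+1]. *)
Lemma adapted_step k v : {subset s' k <= v} -> xi_ k \in v ->
  adapted_L2 (s' k) (z k) -> adapted_L2 (s k) (dia k) ->
  [/\ adapted_L2 (s' k) (e k), adapted_L2 (s' k) (w k),
      adapted_L2 v (eps k) & adapted_L2 v (z k.+1)].
Proof.
move=> s'v xiv az adia; have adia' := adaptedW (@ss' k) adia.
have ae : adapted_L2 (s' k) (e k) by exact: (adapted_noise _ _ (@ss' k)).
have aFs : adapted_L2 (s' k) (fun t => Fs (dia k t) (X (tri_ k) t)).
  rewrite (_ : (fun t => _) = fun t => F (dia k t) + e k t).
    by apply: adapted_D => //; exact: (adapted_lip lipF).
  by apply/funext => t; rewrite /e /noise addrC subrK.
have aw : adapted_L2 (s' k) (w k).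
  rewrite (_ : w k = fun t =>
    prox (alpha k) r (z k t - alpha k *: Fs (dia k t) (X (tri_ k) t))).
    by apply: (adapted_lip (@prox_lip k)); apply: adapted_B => //; exact: adapted_Z.
  by apply/funext => t; rewrite wE.
have aeps : adapted_L2 v (eps k) by exact: (adapted_noise _ _ s'v).
split => //.
have aw' := adaptedW s'v aw.
rewrite (_ : z k.+1 = fun t => w k t + alpha k *:
    (Fs (dia k t) (X (tri_ k) t) - (F (w k t) + eps k t))).
  apply: adapted_D => //; apply: adapted_Z; apply: adapted_B.
    exact: adaptedW s'v aFs.
  by apply: adapted_D => //; exact: (adapted_lip lipF).
by apply/funext => t; rewrite zE /eps /noise (addrC (F _)) subrK.
Qed.

Hypothesis az : forall k, adapted_L2 (s' k) (z k).
Hypothesis adia : forall k, adapted_L2 (s k) (dia k).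
Hypothesis azc : forall k, adapted_L2 (s k) (zc k).
Hypothesis zc_close : forall k t,
  L * (enorm (z k t - zc k t) + alpha k * enorm (e k t)) <= 3 / 4 * enorm (e k t).

Lemma sampled_process_bound (z' w' dia' : nat -> 'rV[R]_m) (K : nat) :
  (forall k, w' k = prox (alpha k) r (z' k - alpha k *: F (dia' k))) ->
  (forall k, z' k.+1 = w' k + alpha k *: (F (dia' k) - F (w' k))) ->
  z' 0 = z0 ->
  [/\ forall k, dia k = z k, forall k, dia' k = z' k &
      forall k, (alpha k * L) ^+ 2 <= 2^-1] \/
  [/\ dia 0 = z 0 /\ dia' 0 = z' 0, forall k, dia k.+1 = w k,
      forall k, dia' k.+1 = w' k & forall k, alpha k * L <= 3^-1] ->
  exists c : Om -> R, [/\ L1 P c,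
    E P c <= 9 * (sigma ^+ 2 * \sum_(k < K) alpha k ^+ 2) &
    forall t y, r y \is a fin_num ->
      \sum_(k < K) alpha k * (dotv (F (w k t)) (w k t - y)
        + (fine (r (w k t)) - fine (r y))) <=
      2^-1 * dotv (z0 - y) (z0 - y) + c t].
Proof.
move=> wE' zE' z0E' cases.
have ae k : adapted_L2 (s' k) (e k) by
  have [] := adapted_step (@s's' k) (xi_s'S k) (az k) (adia k).
have aw k : adapted_L2 (s' k) (w k) by
  have [] := adapted_step (@s's' k) (xi_s'S k) (az k) (adia k).
have aeps k : adapted_L2 (s' k.+1) (eps k) by
  have [] := adapted_step (@s's' k) (xi_s'S k) (az k) (adia k).
have aw0 k : adapted_L2 (s k) (w0 k).
  apply: (adapted_lip (@prox_lip k)); apply: adapted_B => //; apply: adapted_Z.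
  exact: (adapted_lip lipF).
have aS k : adapted_L2 (s' k) (S k).
  elim: k => [|k ih].
    rewrite (_ : S 0 = fun=> 0); first exact: adapted_cst.
    by apply/funext => t; rewrite /S big_ord0.
  rewrite (_ : S k.+1 = fun t => S k t + alpha k *: eps k t).
    apply: adapted_D; last exact: adapted_Z.
    exact: adaptedW (@s's' k) ih.
  by apply/funext => t; rewrite /S big_ord_recr.
have wE1 k t : w k t = prox (alpha k) r (z k t - alpha k *: (F (dia k t) + e k t)).
  by rewrite wE /e /noise (addrC (F _)) subrK.
have zE1 k t : z k.+1 t = w k t +
    alpha k *: ((F (dia k t) + e k t) - (F (w k t) + eps k t)).
  by rewrite zE /e /eps /noise !(addrC (F _)) !subrK.
have w0_close k t : L * enorm (w k t - w0 k t) <= 3 / 4 * enorm (e k t).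
  apply: le_trans (zc_close k t); rewrite ler_pM2l// wE1.
  apply: le_trans (prox_nonexpansive _ _ (al0 k) pr) _.
  rewrite (_ : _ - _ = (z k t - zc k t) - alpha k *: e k t); last first.
    by apply/rowP => i; rewrite !mxE; ring.
  by apply: le_trans (enormD _ _) _; rewrite enormN enormZ gtr0_norm.
have Lz k : L2 P (z k) := (az k).2.
have Lw k : L2 P (w k) := (aw k).2.
have Ldia k : L2 P (dia k) := (adia k).2.
have Lw0 k : L2 P (w0 k) := (aw0 k).2.
have Le k : L2 P (e k) := (ae k).2.
have Leps k : L2 P (eps k) := (aeps k).2.
have e_var k : E P (fun t => dotv (e k t) (e k t)) <= sigma ^+ 2.
  exact: (noise_var (us k) (tri_s k)).
have eps_var k : E P (fun t => dotv (eps k t) (eps k t)) <= sigma ^+ 2.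
  exact: (noise_var (us' k) (xi_s' k)).
have e_orth k g : adapted_L2 (s k) g -> E P (fun t => dotv (e k t) (g t)) = 0.
  exact: (noise_orth (us k) (tri_s k)).
have eps_orth k g : adapted_L2 (s' k) g -> E P (fun t => dotv (eps k t) (g t)) = 0.
  exact: (noise_orth (us' k) (xi_s' k)).
have adia' k := adaptedW (@ss' k) (adia k).
have e_cst k x := e_orth k _ (adapted_cst (s k) x).
have e_dia k := e_orth k _ (adapted_lip lipF (adia k)).
have e_w0 k := e_orth k _ (adapted_lip lipF (aw0 k)).
have eps_cst k x := eps_orth k _ (adapted_cst (s' k) x).
have eps_w k := eps_orth k _ (aw k).
have eps_S k := eps_orth k _ (aS k).
have eps_e k := eps_orth k _ (ae k).
have eps_dia k := eps_orth k _ (adapted_lip lipF (adia' k)).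
have eps_Fw k := eps_orth k _ (adapted_lip lipF (aw k)).
exists (noise_bound alpha z w eps K); split.
- exact: L1_noise_bound.
- case: cases => [[h1 h2 h3]|[[h1 h2] h3 h4 h5]].
  + exact: (E_noise_bound_FBF L0 monoF lipF pr al0 wE1 zE1 z0E wE' zE' z0E'
      Lz Lw Ldia Lw0 Le Leps e_var eps_var e_cst e_dia e_w0 eps_cst eps_w eps_S
      eps_e eps_dia eps_Fw w0_close).
  + exact: (E_noise_bound_FBFp L0 monoF lipF pr al0 wE1 zE1 z0E wE' zE' z0E'
      Lz Lw Ldia Lw0 Le Leps e_var eps_var e_cst e_dia e_w0 eps_cst eps_w eps_S
      eps_e eps_dia eps_Fw w0_close).
- by move=> t y ry; exact: (le_noise_bound pr al0 wE1 zE1 z0E).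
Qed.

End sampled_process.

Section deterministic_run.
Context {R : realType} {m : nat}.
Variables (F : 'rV[R]_m -> 'rV[R]_m) (r : 'rV[R]_m -> \bar R) (alpha : nat -> R)
  (z0 : 'rV[R]_m) (next : 'rV[R]_m -> 'rV[R]_m -> 'rV[R]_m).

(* The noise-free run, as the pair of the iterate [z_k] and of the point at
   which [F] is evaluated in the prox step; [next w z] gives the latter. *)
Fixpoint noise_free (k : nat) : 'rV[R]_m * 'rV[R]_m :=
  if k is j.+1 then
    let: (z, dia) := noise_free j in
    let w := prox (alpha j) r (z - alpha j *: F dia) in
    let z1 := w + alpha j *: (F dia - F w) in (z1, next w z1)
  else (z0, z0).

End deterministic_run.

Section cases.
Context d d' (Om : measurableType d) (Xi : measurableType d') (R : realType)
  (P : probability Om R) (Q : probability Xi R) (m : nat) (L sigma a : R)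
  (F : 'rV[R]_m -> 'rV[R]_m) (Fs : 'rV[R]_m -> Xi -> 'rV[R]_m)
  (r : 'rV[R]_m -> \bar R) (alpha : nat -> R) (z0 : 'rV[R]_m)
  (xi eta : nat -> {mfun Om >-> Xi}) (z w : nat -> Om -> 'rV[R]_m).
Hypotheses (L0 : 0 < L) (monoF : monotone_op F) (lipF : lipschitz_op L F)
  (pr : proper_convex_lsc r) (al0 : forall k, 0 < alpha k)
  (ala : forall k, alpha k <= a) (Fs_est : stochastic_estimator Q sigma F Fs).

Let bound K := exists c : Om -> R, [/\ L1 P c,
    E P c <= 9 * (sigma ^+ 2 * \sum_(k < K) alpha k ^+ 2) &
    forall t y, r y \is a fin_num ->
      \sum_(k < K) alpha k * (dotv (F (w k t)) (w k t - y)
        + (fine (r (w k t)) - fine (r y))) <=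
      2^-1 * dotv (z0 - y) (z0 - y) + c t].

Lemma FBF_bound K : stochastic_FBF P Q Fs r alpha xi eta z0 z w ->
  a <= (Num.sqrt 2 * L)^-1 -> bound K.
Proof.
move=> [drawn [z0E iter]] aL.
pose X (i : nat + nat) := match i with inl k => xi k | inr k => eta k end.
(* The order of drawing is eta_0, xi_0, eta_1, xi_1, and so on: [s k] stops before eta_k, and [s' k]
   before xi_k. *)
pose s k : seq (nat + nat) := map inl (iota 0 k) ++ map inr (iota 0 k).
pose s' k : seq (nat + nat) := inr k :: s k.
have inl_inj : injective (@inl nat nat) by move=> ? ? [].
have inr_inj : injective (@inr nat nat) by move=> ? ? [].
have mem_s k i : (i \in s k) = match i with
      inl j => (j < k)%N | inr j => (j < k)%N end.
  rewrite mem_cat; case: i => j.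
    rewrite (mem_map inl_inj) mem_iota /= add0n.
    by rewrite (_ : inl j \in map inr _ = false) ?orbF//; apply/mapP => -[].
  rewrite (mem_map inr_inj) mem_iota /= add0n.
  by rewrite (_ : inr j \in map inl _ = false)//; apply/mapP => -[].
have us k : uniq (s k).
  rewrite cat_uniq !map_inj_uniq ?iota_uniq//=; try by move=> ? ? [].
  by rewrite andbT; apply/hasPn => _ /mapP[j _ ->]; apply/mapP => -[].
have mem_s' k i : (i \in s' k) = (i == inr k) || (i \in s k) by rewrite inE.
have us' k : uniq (s' k) by rewrite /s' cons_uniq us mem_s ltnn.
have xi_s' k : (inl k : nat + nat) \notin s' k by rewrite mem_s' mem_s ltnn.
have ss' k : {subset s k <= s' k} by move=> i si; rewrite mem_s' si orbT.
have s's k : {subset s' k <= s k.+1}.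
  by move=> i; rewrite mem_s' => /predU1P[->|]; rewrite !mem_s//; case: i => j /ltnW.
have xi_s k : (inl k : nat + nat) \in s k.+1 by rewrite mem_s.
have s's' k : {subset s' k <= s' k.+1} by move=> i /s's /ss'.
have xi_s'S k : (inl k : nat + nat) \in s' k.+1 by exact: ss'.
have tri_s k : (inr k : nat + nat) \notin s k by rewrite mem_s ltnn.
have tri_s' k : (inr k : nat + nat) \in s' k by rewrite mem_head.
have wE k t : w k t =
    prox (alpha k) r (z k t - alpha k *: Fs (z k t) (X (inr k) t)).
  by have [] := iter k t.
have zE k t : z k.+1 t = w k t +
    alpha k *: (Fs (z k t) (X (inr k) t) - Fs (w k t) (X (inl k) t)).
  by have [] := iter k t.
have az' k : adapted_L2 P X (s k) (z k) -> adapted_L2 P X (s' k) (z k).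
  by case=> m1 m2; split => //; exact: past_funW m1.
have az k : adapted_L2 P X (s k) (z k).
  elim: k => [|k ih].
    rewrite (_ : z 0 = fun=> z0); last by apply/funext => t; rewrite z0E.
    by split; [exact: measurable_cst|exact: L2_cst].
  by have [] := adapted_step lipF pr al0 Fs_est drawn us us' tri_s xi_s' ss' tri_s'
    wE zE (s's k) (xi_s k) (az' k ih) ih.
have aL2 k : (alpha k * L) ^+ 2 <= 2^-1.
  have -> : 2^-1 = ((Num.sqrt 2 : R)^-1) ^+ 2 by rewrite exprVn sqr_sqrtr.
  rewrite lerXn2r ?nnegrE ?mulr_ge0 ?invr_ge0 ?sqrtr_ge0 ?(ltW L0) ?(ltW (al0 k))//.
  rewrite -ler_pdivlMr// -invfM; exact: le_trans (ala k) aL.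
have close k t : L * (enorm (z k t - z k t) +
    alpha k * enorm (noise F Fs (z k t) (X (inr k) t))) <=
    3 / 4 * enorm (noise F Fs (z k t) (X (inr k) t)).
  (* Here 3/4 serves as a rational upper bound of 1 / sqrt 2. *)
  rewrite subrr enorm0 add0r mulrA ler_wpM2r ?enorm_ge0//.
  rewrite mulrC; have := aL2 k; have : 0 <= alpha k * L by rewrite mulr_ge0 ?ltW.
  rewrite expr2; move: (alpha k * L) => x; nra.
pose nf := noise_free F r alpha z0 (fun _ z1 => z1).
have nfE k : (nf k).2 = (nf k).1.
  by case: k => //= k; rewrite /nf/=; case: noise_free.
apply: (sampled_process_bound L0 monoF lipF pr al0 Fs_est drawn us us' tri_s xi_s'
  ss' tri_s' s's' xi_s'S z0E wE zE (fun k => az' k (az k)) az az close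
  (z' := fun k => (nf k).1) (dia' := fun k => (nf k).2)
  (w' := fun k => prox (alpha k) r ((nf k).1 - alpha k *: F (nf k).2))) => //.
- by move=> k; rewrite /nf/=; case: noise_free.
- by left; split.
Qed.

Lemma FBFp_bound K : stochastic_FBFp P Q Fs r alpha xi eta z0 z w ->
  a <= (3 * L)^-1 -> bound K.
Proof.
move=> [drawn [z0E iter]] aL.
pose X (i : option nat) := if i is Some k then xi k else eta 0.
(* [None] is the sample xi_{-1} = eta_0. The prox step k + 1 uses xi_k again, so [s k.+1] is [s' k],
   which stops before xi_k. *)
pose s' k : seq (option nat) := None :: map some (iota 0 k).
pose s k : seq (option nat) := if k is j.+1 then s' j else [::].
pose tri_ k : option nat := if k is j.+1 then Some j else None.
pose dia := delay (cst z0) w.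
have mem_s' k i : (i \in s' k) = if i is Some j then (j < k)%N else true.
  rewrite inE; case: i => [j|//]/=.
  by rewrite (mem_map (@Some_inj _)) mem_iota.
have us' k : uniq (s' k).
  rewrite /= map_inj_uniq ?iota_uniq ?andbT; last by move=> ? ? [].
  by apply/mapP => -[].
have us k : uniq (s k) by case: k => //= k; exact: us'.
have xi_s' k : Some k \notin s' k by rewrite mem_s' ltnn.
have tri_s k : tri_ k \notin s k by case: k.
have tri_s' k : tri_ k \in s' k by case: k => //= k; rewrite mem_s'.
have s's' k : {subset s' k <= s' k.+1}.
  by move=> i; rewrite !mem_s'; case: i => // j /ltnW.
have ss' k : {subset s k <= s' k} by case: k => // k; exact: s's'.
have xi_s'S k : Some k \in s' k.+1 by rewrite mem_s'.
have X_tri k t : (delay (eta 0 : Om -> Xi) (fun k => xi k)) k t = X (tri_ k) t.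
  by case: k.
have wE k t : w k t =
    prox (alpha k) r (z k t - alpha k *: Fs (dia k t) (X (tri_ k) t)).
  by have [] := iter k t; rewrite X_tri.
have zE k t : z k.+1 t = w k t +
    alpha k *: (Fs (dia k t) (X (tri_ k) t) - Fs (w k t) (X (Some k) t)).
  by have [] := iter k t; rewrite X_tri.
have acst u x : adapted_L2 P X u (fun=> x).
  by split; [exact: measurable_cst|exact: L2_cst].
have z0cst : z 0 = cst z0 by apply/funext => t; rewrite z0E.
have step k := adapted_step lipF pr al0 Fs_est drawn us us' tri_s xi_s' ss' tri_s'
    wE zE (s's' k) (xi_s'S k).
have azd k : adapted_L2 P X (s' k) (z k) /\ adapted_L2 P X (s k) (dia k).
  elim: k => [|k [ihz ihd]]; first by rewrite z0cst; split; exact: acst.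
  by have [_ aw _ az] := step k ihz ihd; split.
have az k := (azd k).1; have adia k := (azd k).2.
(* The iterate with the exact F (w_j) in place of its estimate by xi_j, the sample that the prox
   step j + 1 uses again. *)
pose zc k t := if k is j.+1
  then w j t + alpha j *: (Fs (dia j t) (X (tri_ j) t) - F (w j t)) else z0.
have azc k : adapted_L2 P X (s k) (zc k).
  case: k => [|k]; first exact: acst.
  have [_ [mw Lw] [meps Leps] [mz Lz]] := step k (az k) (adia k).
  have [[me Le] _ _ _] := step k (az k) (adia k).
  have [md Ld] := adia k.
  rewrite (_ : zc k.+1 = fun t => w k t + alpha k *:
      ((noise F Fs (dia k t) (X (tri_ k) t) + F (dia k t)) - F (w k t))).
    split.
      apply: measurable_rVD => //; apply: measurable_rVZ; apply: measurable_rVB.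
        apply: measurable_rVD => //; apply: (measurable_lipschitz lipF).
        exact: past_funW md.
      exact: (measurable_lipschitz lipF).
    apply: L2D => //; apply: L2Z; apply: L2B; last exact: (L2_lipschitz lipF).
    by apply: L2D => //; exact: (L2_lipschitz lipF).
  by apply/funext => t; rewrite /zc /noise subrK.
have aL3 k : alpha k * L <= 3^-1.
  by rewrite -ler_pdivlMr// -invfM; exact: le_trans (ala k) aL.
have close k t : L * (enorm (z k t - zc k t) +
    alpha k * enorm (noise F Fs (dia k t) (X (tri_ k) t))) <=
    3 / 4 * enorm (noise F Fs (dia k t) (X (tri_ k) t)).
  rewrite /zc; case: k => [|k].
    rewrite z0E subrr enorm0 add0r; set n := enorm _.
    have n0 : 0 <= n := enorm_ge0 _; have := aL3 0; nra.
  (* The noise left out of [zc k.+1] is the one of the next prox step, so the two contributions add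
     up to the factor (alpha_k + alpha_{k+1}) L <= 2/3 < 3/4. *)
  rewrite zE (_ : _ - _ = - (alpha k *: noise F Fs (w k t) (xi k t))); last first.
    by apply/rowP => i; rewrite !mxE; ring.
  rewrite enormN enormZ gtr0_norm//=; set n := enorm _.
  have n0 : 0 <= n := enorm_ge0 _.
  have := aL3 k; have := aL3 k.+1; nra.
pose nf := noise_free F r alpha z0 (fun w _ => w).
apply: (sampled_process_bound L0 monoF lipF pr al0 Fs_est drawn us us' tri_s xi_s'
  ss' tri_s' s's' xi_s'S z0E wE zE az adia azc close
  (z' := fun k => (nf k).1) (dia' := fun k => (nf k).2)
  (w' := fun k => prox (alpha k) r ((nf k).1 - alpha k *: F (nf k).2))) => //.
- by move=> k; rewrite /nf/=; case: noise_free.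
- right; split => // k.
  by rewrite /nf/=; case: noise_free.
Qed.

End cases.

Theorem theorem3p2 (R : realType) (m : nat) (p : problem R m) (L : R)
    (B : set 'rV[R]_m) (z0 : 'rV[R]_m)
    (d d' : measure_display) (Om : measurableType d) (Xi : measurableType d')
    (P : probability Om R) (Q : probability Xi R)
    (Fs : 'rV[R]_m -> Xi -> 'rV[R]_m) (sigma : R)
    (alpha : nat -> R) (a : R) (xi eta : nat -> {mfun Om >-> Xi})
    (z w : nat -> Om -> 'rV[R]_m) :
  let F := operator p in
  let r := regularizer p in
  0 < L ->
  monotone_op F ->
  lipschitz_op L F ->
  proper_convex_lsc r ->
  minimax_assumptions L p ->
  compact B ->
  B z0 ->
  stochastic_estimator Q sigma F Fs ->
  (forall k, independent_rv P (xi k) (w k : Om -> borel_rV R m)) ->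
  (forall k, 0 < alpha k) ->
  (forall k, alpha k <= a) ->
  (stochastic_FBF P Q Fs r alpha xi eta z0 z w /\ a <= (Num.sqrt 2 * L)^-1) \/
  (stochastic_FBFp P Q Fs r alpha xi eta z0 z w /\ a <= (3 * L)^-1) ->
  forall K : nat, (1 <= K)%N ->
  (\int[P]_om gap p B (averaged alpha w K om) <=
     ((diameter B ^+ 2 + 18 * sigma ^+ 2 * \sum_(k < K) alpha k ^+ 2)
      / (2 * \sum_(k < K) alpha k))%:E)%E.
Proof.
move=> F r L0 monoF lipF pr minimax cB Bz0 Fs_est _ al0 ala algo K K0.
have [c [Lc Ec hc]] : exists c : Om -> R, [/\ L1 P c,
    E P c <= 9 * (sigma ^+ 2 * \sum_(k < K) alpha k ^+ 2) &
    forall t y, r y \is a fin_num ->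
      \sum_(k < K) alpha k * (dotv (F (w k t)) (w k t - y)
        + (fine (r (w k t)) - fine (r y))) <=
      2^-1 * dotv (z0 - y) (z0 - y) + c t].
  by case: algo => -[algo aL];
    [exact: (FBF_bound L0 monoF lipF pr al0 ala Fs_est K algo aL)|
     exact: (FBFp_bound L0 monoF lipF pr al0 ala Fs_est K algo aL)].
have rw k t : r (w k t) \is a fin_num.
  by case: algo => -[[_ [_ /(_ k t)[-> _]]] _]; exact: prox_fin_num.
have T0 := sum_weights_gt0 al0 K0; set T := \sum_(k < K) alpha k in T0 *.
(* An integrable majorant of the gap that is free of [y]: |z_0 - y| is at most the diameter because
   both points lie in [B]. *)
pose C t := T^-1 * (2^-1 * diameter B ^+ 2 + c t).
have LC : L1 P C by apply: L1Z; apply: L1D => //; exact: L1_cst.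
apply: (@le_trans _ _ (\int[P]_t (C t)%:E)%E).
  apply: le_integralT => t.
  apply: (gap_average_le al0 (x := fun k => w k t) K0 monoF pr minimax) => //.
  move=> y By ry; apply: le_trans (hc t y ry) _; rewrite lerD2r ler_pM2l//.
  have z0y := diameter_ge cB Bz0 By.
  by rewrite -enorm_sqr lerXn2r ?nnegrE ?(le_trans (enorm_ge0 _) z0y) ?enorm_ge0.
rewrite -E_EFin// lee_fin /C EZ; last by apply: L1D => //; exact: L1_cst.
rewrite ED ?E_cst//; last exact: L1_cst.
rewrite ler_pdivlMr ?mulr_gt0//.
rewrite (_ : _ * _ * _ = 2 * (2^-1 * diameter B ^+ 2 + E P c)).
  by move: (\sum_(k < K) alpha k ^+ 2) Ec => V; lra.
by field; rewrite gt_eqF.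
Qed.
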